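(* Let $\bar A=(A_0,A_1)$ be a compatible couple of (quasi-)Banach spaces with $A_0\cap A_1\neq\{0\}$. Let $0<\theta,\theta_0<1$, $0<q_0,r,r_0,r_1\le\infty$, $a,b_0,b_1,a_0\in SV$, $\left\|s^{-1/r_0}\frac{b_0(s)}{a_0(s)}\right\|_{r_0,(0,1)}<\infty$, and $\left\|s^{-1/r_1}b_1(s)\right\|_{r_1,(0,1)}<\infty$. Put $c_0(t)=a_0(t)\left\|s^{-1/r_0}\frac{b_0(s)}{a_0(s)}\right\|_{r_0,(0,t)}$, $c_1(t)=\left\|s^{-1/r_1}b_1(s)\right\|_{r_1,(0,t)}$, and $\rho(t)=t^{1-\theta_0}\frac{c_0(t)}{c_1(t)}$ for $t>0$. Then $$\left(\bar A^{\mathcal R}_{\theta_0,r_0,b_0,q_0,a_0},\bar A_{1,r_1,b_1}\right)_{\theta,r,a}\cong\bar A_{\eta,r,a^{\#}},$$ where $\eta=(1-\theta)\theta_0+\theta$ and $a^{\#}(t)=c_0(t)^{1-\theta}c_1(t)^{\theta}a(\rho(t))$.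
   Context: For a compatible couple $\bar X=(X_0,X_1)$ of (quasi-)Banach spaces, $f\in X_0+X_1$ and $t>0$, $K(t,f)=K(t,f;\bar X)=\inf\{\|f_0\|_{X_0}+t\|f_1\|_{X_1}: f=f_0+f_1,\ f_i\in X_i\}$. $\|\cdot\|_{q,(c,d)}$ ($0<q\le\infty$) is the usual (quasi-)norm of the Lebesgue space $L_q$ on the interval $(c,d)$ with Lebesgue measure (variable of integration: the displayed variable; $1/\infty=0$). $SV$ is the set of positive Lebesgue measurable functions $b$ on $(0,\infty)$ that are slowly varying: for each $\varepsilon>0$, $t^{\varepsilon}b(t)$ is equivalent to an increasing function and $t^{-\varepsilon}b(t)$ is equivalent to a decreasing function, where two positive functions are equivalent if each is bounded by a constant multiple of the other. For $0\le\theta\le1$, $0<q\le\infty$, $b\in SV$, $\bar X_{\theta,q,b}=(X_0,X_1)_{\theta,q,b}$ is the space of $f\in X_0+X_1$ with $\|f\|=\left\|u^{-\theta-1/q}b(u)K(u,f)\right\|_{q,(0,\infty)}<\infty$. For $0<\sigma<1$, $0<r,q\le\infty$, $a,b\in SV$, $\bar X^{\mathcal R}_{\sigma,r,b,q,a}$ is the space of $f\in X_0+X_1$ with $\|f\|=\left\|t^{-1/r}\frac{b(t)}{a(t)}\left\|u^{-\sigma-1/q}a(u)K(u,f)\right\|_{q,(t,\infty)}\right\|_{r,(0,\infty)}<\infty$. $X\cong Y$ means that $X$ and $Y$ are continuously embedded in each other (same space, equivalent quasi-norms). *)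

(* Defs.v *)
From mathcomp Require Import all_boot all_order all_algebra.
From mathcomp Require Import all_classical all_reals all_analysis.

Set Implicit Arguments.
Unset Strict Implicit.
Unset Printing Implicit Defensive.

Import Order.TTheory GRing.Theory Num.Theory.
Import numFieldNormedType.Exports.

Local Open Scope classical_set_scope.
Local Open Scope ring_scope.

(* [@completed_lebesgue_measure R] lives on the Caratheodory sigma-algebra, i.e.
   the Lebesgue measurable sets; the carrier of [lebesgue_measurableType R] is
   convertible to [R]. *)
Definition lebesgue_measurableType (R : realType) :=
  caratheodory_type (wlength (@idfun R))^*%mu.

Definition leb_measurable (R : realType) (D : set R) (f : R -> R) : Prop :=
  @measurable_fun _ _ (lebesgue_measurableType R) (measurableTypeR R) D f.

(* The L_q (quasi-)norm over D, for 0 < q <= +oo; [g \_ D] is 0 outside D. *)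
Definition Lq_norm (R : realType) (q : \bar R) (D : set R) (g : R -> \bar R) :
    \bar R :=
  Lnorm (@completed_lebesgue_measure R) q (g \_ D).

(* 1/q, with 1/oo = 0. *)
Definition qinv (R : realType) (q : \bar R) : R := fine (q^-1)%E.

Section SlowlyVarying.
Variable R : realType.
Implicit Types f g b : R -> R.

Definition equiv_pos f g : Prop :=
  exists2 C : R, 0 < C & forall t, 0 < t -> f t <= C * g t /\ g t <= C * f t.

(* Weak or strict monotonicity makes no difference up to equivalence, and the
   comparison functions are automatically positive on ]0, +oo[. *)
Definition increasing_pos g : Prop :=
  forall s t, 0 < s -> s <= t -> g s <= g t.

Definition decreasing_pos g : Prop :=
  forall s t, 0 < s -> s <= t -> g t <= g s.

Definition SV b : Prop :=
  [/\ forall t, 0 < t -> 0 < b t,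
      leb_measurable `]0, +oo[ b &
      forall e, 0 < e ->
        (exists2 g, increasing_pos g & equiv_pos (fun t => t `^ e * b t) g) /\
        (exists2 g, decreasing_pos g & equiv_pos (fun t => t `^ (- e) * b t) g)].

End SlowlyVarying.

(* A quasi-normed space inside an ambient vector space V; the values of [qnorm]
   outside [carrier] are irrelevant. Scalars are real: a complex space is also a
   real one, with the same quasi-norm, topology, K-functional and interpolation
   spaces. *)
Record qspace (R : realType) (V : lmodType R) :=
  QSpace { carrier : set V ; qnorm : V -> R }.

Section QuasiBanach.
Variables (R : realType) (V : lmodType R).
Implicit Types X Y : qspace V.

Definition subspace X : Prop :=
  carrier X 0 /\
  forall (k : R) x y, carrier X x -> carrier X y -> carrier X (k *: x + y).

Definition is_quasinorm X : Prop :=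
  [/\ forall x, carrier X x -> 0 <= qnorm X x,
      forall x, carrier X x -> qnorm X x = 0 -> x = 0,
      forall (k : R) x, carrier X x -> qnorm X (k *: x) = `|k| * qnorm X x &
      exists C : R, forall x y, carrier X x -> carrier X y ->
        qnorm X (x + y) <= C * (qnorm X x + qnorm X y)].

Definition qcomplete X : Prop :=
  forall u : nat -> V, (forall n, carrier X (u n)) ->
    (forall e : R, 0 < e -> exists N : nat, forall m n : nat,
      (N <= m)%N -> (N <= n)%N -> qnorm X (u m - u n) < e) ->
    exists2 x, carrier X x & forall e : R, 0 < e ->
      exists N : nat, forall n : nat, (N <= n)%N -> qnorm X (u n - x) < e.

Definition quasi_banach X : Prop :=
  [/\ subspace X, is_quasinorm X & qcomplete X].

Definition embedded X Y : Prop :=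
  carrier X `<=` carrier Y /\
  exists C : R, forall f, carrier X f -> qnorm Y f <= C * qnorm X f.

Definition iso_spaces X Y : Prop := embedded X Y /\ embedded Y X.

End QuasiBanach.

(* Continuity of the linear inclusion of X in V, i.e. continuity at 0. *)
Definition continuously_included (R : realType) (V : topologicalLmodType R)
    (X : qspace V) : Prop :=
  forall U : set V, nbhs (0 : V) U ->
    exists2 d : R, 0 < d & forall x, carrier X x -> qnorm X x < d -> U x.

Definition compatible_couple (R : realType) (V : topologicalLmodType R)
    (A0 A1 : qspace V) : Prop :=
  [/\ hausdorff_space V, quasi_banach A0, quasi_banach A1,
      continuously_included A0 & continuously_included A1].

Section Interpolation.
Variables (R : realType) (V : lmodType R).

Definition sum_space (X0 X1 : qspace V) : set V :=
  [set f | exists f0 f1, [/\ carrier X0 f0, carrier X1 f1 & f = f0 + f1]].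

Definition Kfun (X0 X1 : qspace V) (t : R) (f : V) : R :=
  inf [set k | exists f0 f1, [/\ carrier X0 f0, carrier X1 f1, f = f0 + f1 &
                                 k = qnorm X0 f0 + t * qnorm X1 f1]].

Definition finite_norm_space (S : set V) (N : V -> \bar R) : qspace V :=
  QSpace (S `&` [set f | (N f < +oo)%E]) (fun f => fine (N f)).

Definition interp_norm (X0 X1 : qspace V) (theta : R) (q : \bar R)
    (b : R -> R) (f : V) : \bar R :=
  Lq_norm q `]0, +oo[
    (fun u => (u `^ (- theta - qinv q) * b u * Kfun X0 X1 u f)%:E).

Definition interp (X0 X1 : qspace V) (theta : R) (q : \bar R) (b : R -> R) :
    qspace V :=
  finite_norm_space (sum_space X0 X1) (interp_norm X0 X1 theta q b).

Definition interpR_norm (X0 X1 : qspace V) (sigma : R) (r : \bar R) (b : R -> R)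
    (q : \bar R) (a : R -> R) (f : V) : \bar R :=
  Lq_norm r `]0, +oo[
    (fun t => (t `^ (- qinv r) * (b t / a t))%:E *
       Lq_norm q `]t, +oo[
         (fun u => (u `^ (- sigma - qinv q) * a u * Kfun X0 X1 u f)%:E))%E.

Definition interpR (X0 X1 : qspace V) (sigma : R) (r : \bar R) (b : R -> R)
    (q : \bar R) (a : R -> R) : qspace V :=
  finite_norm_space (sum_space X0 X1) (interpR_norm X0 X1 sigma r b q a).

End Interpolation.

(* Main.v *)
(** Write K for the K-functional of (A0, A1), K' for that of the two end spaces, and
    w(t) = t^(-eta) a#(t) = rho(t)^(-theta) a(rho(t)) t^(-theta0) c0(t). Monotonicity
    of K and of K(t)/t bounds t^(-theta0) c0(t) K(t, f) by a multiple of
    K'(rho(t), f). Conversely a nearly optimal decomposition of f for K(t, f) shows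
    that w(t) K'(rho(t), f) is at most a multiple of t^(-theta0) c0(t) times the
    supremum over u of w(u) K(u, f) exp(-de |ln u - ln t|). Hence, with
    G(t) = w(t) K(t, f) and F(s) = s^(-theta) a(s) K'(s, f), the value F(rho(t)) lies
    between G(t) and a geometrically weighted supremum of G. Both functions are
    essentially constant on the cells of a geometric grid, and rho maps such a grid to
    a sequence with ratios bounded above and away from 1, so the norms of F and G in
    L_r(ds/s) are equivalent by convolution with a geometric kernel. *)

Require Import Defs.
From mathcomp Require Import all_boot all_order all_algebra.
From mathcomp Require Import all_classical all_reals all_analysis.
From mathcomp Require Import ess_sup_inf measurable_realfun ring lra zify.

Set Implicit Arguments.
Unset Strict Implicit.
Unset Printing Implicit Defensive.

Import Order.TTheory GRing.Theory Num.Theory.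
Import numFieldNormedType.Exports.

Local Open Scope classical_set_scope.
Local Open Scope ring_scope.

(** * Regular variation *)

(** Slowly varying functions are therefore used only through logarithmic bounds with constants, and
    both norms are compared with sums of samples, taken at grid points [x k] for one function and at
    [rho (x k)] for the other, indexed by the same k. Raising to the power r before summing makes
    the comparison valid for r < 1 as well. The room for all losses comes from theta0 < eta < 1: the
    margins theta0, eta - theta0 and 1 - eta are positive, and a fraction of the smallest one fixes
    the rate [de]. Every constant is chosen before f. The estimate that bounds K' from above also
    produces the decomposition of f in the sum of the end spaces, so membership and the norm bound
    come together. *)

Section RegularVariation.
Variable R : realType.
Implicit Types (al be e : R) (b g : R -> R).

(* Regular variation of index [al], as Potter bounds up to a constant. *)
Definition RV al b : Prop := (forall t, 0 < t -> 0 < b t) /\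
  forall e, 0 < e -> exists C, forall s t, 0 < s -> 0 < t ->
    `|ln (b s) - ln (b t) - al * (ln s - ln t)| <= C + e * `|ln s - ln t|.

(** Comparing [b s] with [b t] through a monotone function uses the equivalence twice, which gives
    [2 * ln C]. The increasing and the decreasing function bound the difference of logarithms from
    the two sides. *)
Lemma SV_RV b : SV b -> RV 0 b.
Proof.
move=> [b0 _ bSV]; split=> // e e0.
have [[g gi [C C0 gC]] [h hd [C' C0' hC']]] := bSV e e0.
exists (`|2 * ln C| + `|2 * ln C'|).
have lnb s : 0 < s -> forall x, ln (s `^ x * b s) = x * ln s + ln (b s).
  by move=> s0 x; rewrite lnM ?posrE ?powR_gt0 ?b0// ln_powR.
have p s : 0 < s -> forall x, 0 < s `^ x * b s.
  by move=> s0 x; rewrite mulr_gt0 ?powR_gt0 ?b0.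
suff H s t : 0 < s -> 0 < t -> s <= t ->
    `|ln (b s) - ln (b t)| <= `|2 * ln C| + `|2 * ln C'| + e * (ln t - ln s).
  move=> s t s0 t0; rewrite mul0r subr0; have [st|ts] := leP s t.
    rewrite (distrC (ln s)) (ger0_norm (x := ln t - ln s)) ?subr_ge0 ?ler_ln ?posrE//.
    exact: H.
  rewrite (ger0_norm (x := ln s - ln t)) ?subr_ge0 ?ler_ln ?posrE ?(ltW ts)//.
  by rewrite distrC; apply: H => //; exact: ltW.
move=> s0 t0 st.
have h1 : s `^ e * b s <= C * (C * (t `^ e * b t)).
  have [+ _] := gC _ s0; have [_ +] := gC _ t0 => /= h1 h2.
  apply: (le_trans h2); rewrite ler_pM2l//; apply: le_trans h1; exact: gi.
have h2 : t `^ (- e) * b t <= C' * (C' * (s `^ (- e) * b s)).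
  have [_ +] := hC' _ s0; have [+ _] := hC' _ t0 => /= h2 h3.
  apply: (le_trans h2); rewrite ler_pM2l//; apply: le_trans h3; exact: hd.
move: h1 h2; rewrite -ler_ln ?posrE ?mulr_gt0 ?p ?b0 ?powR_gt0// lnb//.
rewrite lnM ?posrE ?mulr_gt0 ?p ?b0 ?powR_gt0// lnM ?posrE ?mulr_gt0 ?p ?b0 ?powR_gt0//.
rewrite lnb// => h1.
rewrite -ler_ln ?posrE ?mulr_gt0 ?p ?b0 ?powR_gt0// lnb//.
rewrite lnM ?posrE ?mulr_gt0 ?p ?b0 ?powR_gt0// lnM ?posrE ?mulr_gt0 ?p ?b0 ?powR_gt0//.
rewrite lnb// => h2.
have := ler_norm (2 * ln C); have := ler_norm (2 * ln C').
have := normr_ge0 (2 * ln C); have := normr_ge0 (2 * ln C').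
move: `|2 * ln C| `|2 * ln C'| => x y ? ? ? ?.
rewrite ler_norml; apply/andP; split; lra.
Qed.

Lemma RV_gt0 al b t : RV al b -> 0 < t -> 0 < b t.
Proof. by case=> + _; apply. Qed.

Lemma RV_powR al : RV al (fun t => t `^ al).
Proof.
split=> [t t0|e e0]; first exact: powR_gt0.
exists 0 => s t s0 t0; rewrite !ln_powR -mulrBr subrr normr0 add0r.
by rewrite mulr_ge0// ltW.
Qed.

Lemma RVM al be b g : RV al b -> RV be g -> RV (al + be) (fun t => b t * g t).
Proof.
move=> [b0 bP] [g0 gP]; split=> [t t0|e e0]; first by rewrite mulr_gt0 ?b0 ?g0.
have e20 : 0 < e / 2 by rewrite divr_gt0.
have [C1 H1] := bP _ e20; have [C2 H2] := gP _ e20; exists (C1 + C2) => s t s0 t0.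
rewrite !lnM ?posrE ?b0 ?g0//.
have := H1 _ _ s0 t0; have := H2 _ _ s0 t0 => h2 h1.
apply: (le_trans _ (le_trans (lerD h1 h2) _)); last by lra.
by apply: (le_trans _ (ler_normD _ _)); rewrite le_eqVlt; apply/orP; left; apply/eqP; congr
    `|_|; ring.
Qed.

Lemma RV_pow al ga b : RV al b -> RV (ga * al) (fun t => b t `^ ga).
Proof.
move=> [b0 bP]; split=> [t t0|e e0]; first by rewrite powR_gt0 ?b0.
(* The summand 1 keeps the divisor positive when [ga] is 0. *)
have ga0 : 0 < `|ga| + 1 by rewrite ltr_pwDr.
have [C H] := bP (e / (`|ga| + 1)) (divr_gt0 e0 ga0).
exists (`|ga| * C) => s t s0 t0; rewrite !ln_powR.
rewrite -mulrBr -mulrA -mulrBr normrM.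
apply: (le_trans (ler_wpM2l (normr_ge0 _) (H _ _ s0 t0))).
rewrite mulrDr lerD2l mulrA; apply: ler_wpM2r; first exact: normr_ge0.
by rewrite mulrA ler_pdivrMr// mulrC ler_wpM2l ?(ltW e0)// lerDl.
Qed.

Lemma RV_inv al b : RV al b -> RV (- al) (fun t => (b t)^-1).
Proof.
move=> [b0 bP]; split=> [t t0|e e0]; first by rewrite invr_gt0 b0.
have [C H] := bP e e0; exists C => s t s0 t0; rewrite !lnV ?posrE ?b0//.
apply: (le_trans _ (H _ _ s0 t0)); rewrite -normrN le_eqVlt; apply/orP; left.
by apply/eqP; congr `|_|; ring.
Qed.

Lemma RV_div al be b g : RV al b -> RV be g -> RV (al - be) (fun t => b t / g t).
Proof. by move=> hb /RV_inv hg; exact: (RVM hb hg). Qed.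

(** [b] sees only the variation of [ln g], which is at most (|al| + 1) |ln s - ln t| plus a
    constant. Dividing [e] by |al| + 1 compensates for the factor. *)
Lemma RV_comp al b g : RV 0 b -> RV al g -> RV 0 (fun t => b (g t)).
Proof.
move=> [b0 bP] [g0 gP]; split=> [t t0|e e0]; first by rewrite b0 ?g0.
have [C1 H1] := gP 1 ltr01.
have ga0 : 0 < `|al| + 1 by rewrite ltr_pwDr.
have e'0 := divr_gt0 e0 ga0.
have [C H] := bP _ e'0.
exists (C + (e / (`|al| + 1)) * C1) => s t s0 t0.
have := H _ _ (g0 _ s0) (g0 _ t0); rewrite !mul0r !subr0 => /le_trans; apply.
have -> : e * `|ln s - ln t| = e / (`|al| + 1) * ((`|al| + 1) * `|ln s - ln t|).
  by rewrite mulrA divfK ?gt_eqF.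
rewrite -addrA lerD2l -mulrDr ler_pM2l//.
have -> : ln (g s) - ln (g t) = (ln (g s) - ln (g t) - al * (ln s - ln t)) + al * (ln s - ln
    t).
  by rewrite subrK.
apply: (le_trans (ler_normD _ _)).
apply: (le_trans (lerD (H1 _ _ s0 t0) (lexx _))).
by rewrite normrM -addrA lerD2l addrC mulrDl.
Qed.

Lemma RV_le al b e : RV al b -> 0 < e ->
  exists2 C, 0 < C & forall s t, 0 < s -> 0 < t ->
    b s <= C * expR (al * (ln s - ln t) + e * `|ln s - ln t|) * b t.
Proof.
move=> [b0 bP] e0; have [C H] := bP e e0; exists (expR C); first exact: expR_gt0.
move=> s t s0 t0; rewrite -expRD -ler_ln ?posrE ?b0 ?mulr_gt0 ?expR_gt0//; last exact: b0.
rewrite lnM ?posrE ?expR_gt0 ?b0// expRK.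
by have := ler_normlW (H _ _ s0 t0); lra.
Qed.

End RegularVariation.

(** * Norms of nonnegative functions *)

Section NonmeasurableIntegral.
Local Open Scope ereal_scope.
Context d (T : measurableType d) (R : realType) (mu : {measure set T -> \bar R}).
Implicit Types f g : T -> \bar R.

Import HBNNSimple.

(* [integral] of a nonnegative function is its lower integral, hence monotone and
   homogeneous without measurability: this matters as [a \o rho] need not be
   measurable. *)
Lemma le_lower_integral f g : (forall x, 0 <= f x) -> (forall x, f x <= g x) ->
  \int[mu]_x f x <= \int[mu]_x g x.
Proof.
move=> f0 fg; have g0 x : 0 <= g x by exact: le_trans (fg x).
rewrite !ge0_integralTE//; apply: le_ereal_sup => _ [h hf <-].
by exists h => // x; exact: le_trans (fg x).
Qed.

(** A simple function below [k f] becomes one below [f] after division by [k], whether or not [f] is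
    measurable. *)
Lemma lower_integralZ (k : R) f : (0 < k)%R -> (forall x, 0 <= f x) ->
  \int[mu]_x (k%:E * f x) <= k%:E * \int[mu]_x f x.
Proof.
move=> k0 f0; have kf0 x : 0 <= k%:E * f x by rewrite mule_ge0// lee_fin ltW.
have ki : (0 <= k^-1)%R by rewrite invr_ge0 ltW.
rewrite !ge0_integralTE//; apply: ge_ereal_sup => _ [h /= hf <-].
rewrite -lee_pdivrMl// -(sintegralrM mu k^-1 h).
apply: ereal_sup_ubound; exists (scale_nnsfun h ki) => //= x.
by rewrite EFinM lee_pdivrMl.
Qed.

Lemma Lnorm_le (p : \bar R) f g : 0 < p ->
  (forall x, 0 <= f x) -> (forall x, f x <= g x) ->
  Lnorm mu p f <= Lnorm mu p g.
Proof.
move=> p0 f0 fg; have g0 x : 0 <= g x by exact: le_trans (fg x).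
rewrite unlock; case: p p0 => [p|_|//].
- rewrite lte_fin => p0; apply: gt0_ler_poweR; rewrite ?invr_ge0 ?(ltW p0)//.
  + by rewrite in_itv/= leey andbT integral_ge0// => x _; exact: poweR_ge0.
  + by rewrite in_itv/= leey andbT integral_ge0// => x _; exact: poweR_ge0.
  + apply: le_lower_integral => x; first exact: poweR_ge0.
    by apply: gt0_ler_poweR; rewrite ?(ltW p0)// ?in_itv/= ?leey ?andbT// ?gee0_abs.
- case: ifPn => // _; apply: le_ess_sup; apply: nearW => x /=.
  by rewrite !gee0_abs.
Qed.

Lemma Lnorm_scale_le (p : \bar R) (k : R) f : 0 < p -> (0 < k)%R ->
  (forall x, 0 <= f x) ->
  Lnorm mu p (fun x => k%:E * f x) <= k%:E * Lnorm mu p f.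
Proof.
move=> p0 k0 f0; have k0' : 0 <= k%:E by rewrite lee_fin ltW.
have i0 p' : 0 <= \int[mu]_x `|f x| `^ p' by rewrite integral_ge0// => x _; exact: poweR_ge0.
rewrite unlock; case: p p0 => [p|_|//].
- rewrite lte_fin => p0.
  have -> : k%:E = (k%:E `^ p) `^ p^-1.
    by rewrite -poweRrM divff ?gt_eqF// poweRe1.
  rewrite -poweRM ?poweR_ge0//.
  apply: gt0_ler_poweR; rewrite ?invr_ge0 ?(ltW p0)//.
  + by rewrite in_itv/= leey andbT integral_ge0// => x _; exact: poweR_ge0.
  + by rewrite in_itv/= leey andbT; apply: mule_ge0; rewrite ?i0 ?lee_fin ?powR_ge0.
  + rewrite -poweRrM divff ?gt_eqF// poweRe1// [k%:E `^ p]poweR_EFin.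
    apply: le_trans (lower_integralZ _ _) => //; [|exact: powR_gt0|by move=> x; exact:
        poweR_ge0].
    apply: le_lower_integral => x; first exact: poweR_ge0.
    by rewrite abseM poweRM// [`|k%:E|]gee0_abs.
- case: ifPn => [_|_]; last by rewrite mule0.
  apply/ess_supP; have := ess_sup_ge mu (abse \o f).
  apply: filterS => x /= fx; rewrite abseM [`|k%:E|]gee0_abs//.
  exact: lee_wpmul2l.
Qed.

End NonmeasurableIntegral.

Section WeightedNorm.
Variable R : realType.
Implicit Types (q : \bar R) (D : set R) (F G : R -> R).

Local Notation T := (lebesgue_measurableType R).
Local Notation mu := (@completed_lebesgue_measure R : {measure set T -> \bar R}).

Lemma lebesgue_measurable_sub (A : set R) :
  measurable (A : set (measurableTypeR R)) -> measurable (A : set T).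
Proof. exact: sub_caratheodory. Qed.

Lemma completed_measure_itv (i : interval R) : mu [set` i] =
  (if i.1 < i.2 then (i.2 : \bar R) - i.1 else 0)%E.
Proof. exact: lebesgue_measure_itv. Qed.

Lemma Lq_norm_le q D D' (f g : R -> \bar R) : (0 < q)%E -> D `<=` D' ->
  (forall x, D x -> 0 <= f x)%E -> (forall x, D' x -> 0 <= g x)%E ->
  (forall x, D x -> f x <= g x)%E -> (Lq_norm q D f <= Lq_norm q D' g)%E.
Proof.
move=> q0 DD f0 g0 fg; apply: Lnorm_le => // x.
- by apply: erestrict_ge0.
- rewrite /patch; case: ifPn => [/set_mem Dx|_].
    by rewrite mem_set ?fg//; exact: DD.
  exact: (erestrict_ge0 (D := D') (f := g)).
Qed.

Lemma Lq_norm_scale q D (k : R) (f : R -> \bar R) : (0 < q)%E -> 0 < k ->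
  (forall x, D x -> 0 <= f x)%E ->
  (Lq_norm q D (fun x => k%:E * f x) <= k%:E * Lq_norm q D f)%E.
Proof.
move=> q0 k0 f0; apply: (le_trans _ (Lnorm_scale_le _ _ _ _)) => //; last first.
  by move=> x; exact: erestrict_ge0.
rewrite /Lq_norm le_eqVlt; apply/orP; left; apply/eqP; apply: eq_Lnorm => x.
by rewrite /patch; case: ifPn => //; rewrite mule0.
Qed.

Lemma eq_Lq_norm q D (f g : R -> \bar R) : (forall x, D x -> f x = g x) ->
  Lq_norm q D f = Lq_norm q D g.
Proof.
move=> fg; apply: eq_Lnorm => x; rewrite /patch; case: ifPn => //.
by rewrite inE; exact: fg.
Qed.

Lemma Lq_norm_ge0 q D (f : R -> \bar R) : (0 <= Lq_norm q D f)%E.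
Proof. exact: Lnorm_ge0. Qed.

End WeightedNorm.

Section StepBounds.
Local Open Scope ereal_scope.
Context d (T : measurableType d) (R : realType) (mu : {measure set T -> \bar R}).
Variables (E : nat -> set T) (z : nat -> R) (h : T -> \bar R).
Hypotheses (mE : forall n, measurable (E n)) (z0 : forall n, (0 <= z n)%R)
  (h0 : forall x, 0 <= h x).

Let H x := \sum_(n <oo) ((z n)%:E * (\1_(E n) x)%:E).

Let term_ge0 n x : 0 <= (z n)%:E * (\1_(E n) x)%:E.
Proof. by rewrite mule_ge0 ?lee_fin. Qed.

Let integral_H : \int[mu]_x H x = \sum_(n <oo) ((z n)%:E * mu (E n)).
Proof.
rewrite /H integral_nneseries//; last first.
  move=> n; apply: measurable_funeM; apply/measurable_EFinP.
  exact: measurable_indic.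
apply: eq_eseriesr => n _; rewrite ge0_integralZl_EFin ?integral_indic ?setIT//.
by apply/measurable_EFinP; exact: measurable_indic.
Qed.

(** [h] is enclosed by the measurable step function [H], whose integral is computed term by term.
    Overlaps of the sets are harmless here, because a sum of nonnegative steps dominates each of its
    terms. *)
Lemma lower_integral_step_ub :
  (forall x, h x = 0 \/ exists2 n, E n x & h x <= (z n)%:E) ->
  \int[mu]_x h x <= \sum_(n <oo) ((z n)%:E * mu (E n)).
Proof.
move=> hE; rewrite -integral_H; apply: le_lower_integral => // x.
have [->|[n Enx hz]] := hE x; first by apply: nneseries_ge0 => *; exact: term_ge0.
apply: (le_trans hz); rewrite /H nneseries_esumT; last by move=> *; exact: term_ge0.
apply: esum_ge; exists [set n]; first by split.
by rewrite fsbig_set1 indicE mem_set// mule1.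
Qed.

(** Disjointness makes [H] equal to a single [z n] at each point that it charges. *)
Lemma lower_integral_step_lb : trivIset setT E ->
  (forall n x, E n x -> (z n)%:E <= h x) ->
  \sum_(n <oo) ((z n)%:E * mu (E n)) <= \int[mu]_x h x.
Proof.
move=> tE hE; rewrite -integral_H; apply: le_lower_integral => x.
  by apply: nneseries_ge0 => *; exact: term_ge0.
rewrite /H nneseries_esumT; last by move=> *; exact: term_ge0.
have [[n Enx]|nE] := pselect (exists n, E n x); last first.
  rewrite esum1// => n _; rewrite indicE memNset ?mule0// => Enx.
  by apply: nE; exists n.
rewrite (esumID [set n]); last by move=> *; exact: term_ge0.
rewrite setTI esum_set1 ?term_ge0// esum1 ?adde0.
  by rewrite indicE mem_set// mule1; exact: hE.
move=> m [_ /= mn]; rewrite indicE memNset ?mule0// => Emx.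
by apply: mn; apply: (tE m n) => //; exists x.
Qed.

End StepBounds.

Section WN.
Variable R : realType.
Implicit Types (q : \bar R) (D : set R) (F G : R -> R).

Local Notation T := (lebesgue_measurableType R).
Local Notation mu := (@completed_lebesgue_measure R : {measure set T -> \bar R}).

(* The L_q norm of [F] for the measure ds/s. *)
Definition Lq_haar q D F : \bar R :=
  Lq_norm q D (fun s => (s `^ (- qinv q) * F s)%:E).

Lemma qinvE (p : R) : 0 < p -> qinv p%:E = p^-1.
Proof. by move=> p0; rewrite /qinv inver gt_eqF. Qed.

Lemma qinvy : qinv (+oo%E : \bar R) = 0.
Proof. by rewrite /qinv invey. Qed.

Lemma Lq_haar_ge0 q D F : (0 <= Lq_haar q D F)%E.
Proof. exact: Lq_norm_ge0. Qed.

(** Norm estimates are passed on with a real bound [B]: finiteness travels with the inequality, and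
    constants multiply in [R]. *)
Lemma Lq_haar_bound q D D' F G (k B : R) : (0 < q)%E -> 0 < k -> D `<=` D' ->
  (forall s, D s -> 0 <= F s) -> (forall s, D' s -> 0 <= G s) ->
  (forall s, D s -> F s <= k * G s) ->
  (Lq_haar q D' G <= B%:E)%E -> (Lq_haar q D F <= (k * B)%:E)%E.
Proof.
move=> q0 k0 DD F0 G0 FG GB.
have k0' : (0 <= k%:E)%E by rewrite lee_fin ltW.
apply: (@le_trans _ _ (k%:E * Lq_haar q D' G)%E); last first.
  by rewrite EFinM lee_pmul2l// lte_fin.
apply: (le_trans _ (Lq_norm_scale _ _ _)) => //; last first.
  by move=> x Dx; rewrite lee_fin mulr_ge0 ?powR_ge0 ?G0.
apply: Lq_norm_le => // x Dx; rewrite ?mule_ge0 ?lee_fin ?mulr_ge0 ?powR_ge0 ?G0 ?F0//.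
by rewrite mulrCA; apply: ler_wpM2l; [exact: powR_ge0|exact: FG].
Qed.

(** The p-th power of the norm, with the weight already reduced to [s^-1]; the root 1/p is confined
    to [Lq_haar_leP]. *)
Definition haar_int (p : R) D F :=
  (\int[mu]_x (((fun s => (s^-1 * F s `^ p)%:E) \_ D) x))%E.

Lemma Lq_haar_leP (p : R) D F (B : R) : 0 < p -> D `<=` `]0, +oo[ ->
  (forall s, D s -> 0 <= F s) -> 0 <= B ->
  (Lq_haar p%:E D F <= B%:E)%E <-> (haar_int p D F <= (B `^ p)%:E)%E.
Proof.
move=> p0 D0 F0 B0; rewrite /Lq_haar /haar_int /Lq_norm unlock.
have -> : (\int[mu]_x (`|((fun s => (s `^ (- qinv p%:E) * F s)%:E) \_ D) x| `^ p) =
   \int[mu]_x (((fun s => (s^-1 * F s `^ p)%:E) \_ D) x))%E.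
  apply: eq_integral => x _; rewrite /patch; case: ifPn => [/set_mem Dx|_]; last first.
    by rewrite abse0 poweR0r// gt_eqF.
  have x0 : 0 < x by have := D0 _ Dx; rewrite /= in_itv/= andbT.
  rewrite qinvE//= ger0_norm ?mulr_ge0 ?powR_ge0 ?F0//.
  by rewrite powRM ?powR_ge0 ?F0// -powRrM mulNr mulVf ?gt_eqF// powR_inv1 ?ltW.
set I := integral _ _ _.
have I0 : (0 <= I)%E.
  apply: integral_ge0 => x _; apply: erestrict_ge0 => s Ds.
  have s0 : 0 < s by have := D0 _ Ds; rewrite /= in_itv/= andbT.
  by rewrite lee_fin mulr_ge0 ?invr_ge0 ?powR_ge0 ?ltW.
have Bp : (0 <= (B `^ p)%:E)%E by rewrite lee_fin powR_ge0.
split=> h.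
- have -> : I = ((I `^ p^-1) `^ p)%E by rewrite -poweRrM mulVf ?gt_eqF// poweRe1.
  rewrite -poweR_EFin; apply: gt0_ler_poweR => //; rewrite ?(ltW p0)//.
  + by rewrite in_itv/= leey andbT poweR_ge0.
  + by rewrite in_itv/= leey andbT lee_fin.
- have -> : B%:E = ((B `^ p)%:E `^ p^-1)%E.
    by rewrite poweR_EFin -powRrM divff ?gt_eqF// powRr1.
  apply: gt0_ler_poweR => //; rewrite ?invr_ge0 ?(ltW p0)//.
  + by rewrite in_itv/= leey andbT.
  + by rewrite in_itv/= leey andbT.
Qed.

End WN.

Arguments Lq_haar {R} q%_ereal_scope D%_classical_set_scope F%_ring_scope.
Arguments haar_int {R} p%_ring_scope D%_classical_set_scope F%_ring_scope.

(** * Discretisation on logarithmic grids *)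

(** The enumeration 0, -1, 1, -2, 2, ... of the integers, by which sums over grid cells become
    series indexed by [nat]. *)
Definition int_enum (n : nat) : int :=
  if odd n then - (n./2.+1)%:Z else (n./2)%:Z.

Lemma int_enum_bij : set_bij setT setT int_enum.
Proof.
split=> // [m n _ _|k _].
- rewrite /int_enum; have := odd_double_half m; have := odd_double_half n.
  by case: (odd m); case: (odd n) => /=; lia.
- have [k0|k0] := leP 0 k.
    exists (`|k|.*2)%N => //; rewrite /int_enum odd_double doubleK; lia.
  exists (`|k|.-1.*2.+1)%N => //; rewrite /int_enum /= odd_double /= uphalf_double; lia.
Qed.

(** Turns decay in the integer k into decay in its position in the enumeration, at the price of
    halving the rate. *)
Lemma int_enum_absz n : (n <= `|int_enum n|.*2)%N.
Proof.
by rewrite /int_enum; have := odd_double_half n; case: (odd n) => /=; lia.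
Qed.

Section Kernel.
Variable R : realType.

(** Sums of nonnegative terms do not depend on the order, so a translation of the integers may be
    applied although it does not respect [int_enum]. *)
Lemma int_sum_shift (f : int -> \bar R) (m : int) : (forall k, 0 <= f k)%E ->
  (\sum_(n <oo) f (int_enum n) = \sum_(n <oo) f (int_enum n + m)%R)%E.
Proof.
move=> f0; rewrite !nneseries_esumT//.
rewrite -(reindex_esum _ _ _ f int_enum_bij).
rewrite -(reindex_esum _ _ _ (fun k => f (k + m)) int_enum_bij).
apply: (@reindex_esum _ _ _ setT setT (fun k => k + m)); split=> // [k l _ _|k _].
  exact: addIr.
by exists (k - m) => //; rewrite subrK.
Qed.

Lemma int_sum_kernel (c : R) : 0 < c ->
  exists2 B : R, 0 < B & forall m : int,
   (\sum_(n <oo) (expR (- c * `|int_enum n - m|%N%:R))%:E <= B%:E)%E.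
Proof.
(* Half the rate, by [int_enum_absz]; the translation by m then makes the geometric bound uniform in
   m. *)
move=> c0; pose q := expR (- (c / 2)).
have q1 : q < 1 by rewrite /q -expR0 ltr_expR oppr_lt0 divr_gt0.
have q0 : 0 < q by exact: expR_gt0.
exists ((1 - q)^-1); first by rewrite invr_gt0 subr_gt0.
move=> m; have := @int_sum_shift (fun k => (expR (- c * `|k|%N%:R))%:E) (- m).
move=> <-; last by move=> k; rewrite lee_fin expR_ge0.
have f0 n : (0 <= (expR (- c * `|int_enum n|%N%:R))%:E)%E by rewrite lee_fin expR_ge0.
apply: lime_le; first exact: is_cvg_nneseries.
apply: nearW => N.
apply: (@le_trans _ _ (\sum_(0 <= i < N) (q ^+ i)%:E)%E).
  apply: lee_sum => i _; rewrite lee_fin /q -expRM_natl ler_expR.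
  have := int_enum_absz i; rewrite -(ler_nat R) -muln2 natrM.
  by move: (_%:R) (`|_|%N%:R) => x y xy; nra.
rewrite sumEFin lee_fin.
rewrite big_mkord -[leRHS]mul1r ler_pdivlMr ?subr_gt0// mulrC -opprB mulNr -subrX1.
by rewrite opprB lerBlDr lerDl exprn_ge0 ?ltW.
Qed.
End Kernel.

Section Discretization.
Variable R : realType.
Local Notation T := (lebesgue_measurableType R).
Local Notation mu := (@completed_lebesgue_measure R : {measure set T -> \bar R}).

(** [u] lists the logarithms of the grid points. Gaps of at least 1 make the cells disjoint and
    exhaustive, with mass for ds/s bounded below; gaps of at most [M] bound this mass above. *)
Variables (u : int -> R) (M : R).
Hypotheses (u1 : forall k, u k + 1 <= u (k + 1)) (uM : forall k, u (k + 1) <= u k + M).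

Lemma log_grid_addn (k : int) (n : nat) : u k + n%:R <= u (k + n%:Z).
Proof.
elim: n => [|n IH]; first by rewrite !addr0.
rewrite -natr1 addrA; apply: (le_trans (lerD IH (lexx 1))).
by rewrite intS (addrC 1) addrA.
Qed.

Lemma log_grid_lt (k l : int) : k < l -> u (k + 1) <= u l.
Proof.
move=> kl; have -> : l = (k + 1) + `|(l - (k + 1))%R|%N%:Z by lia.
by apply: le_trans (log_grid_addn _ _); rewrite lerDl.
Qed.

Lemma log_grid_cover v : exists k, u k <= v < u (k + 1).
Proof.
have ex n : exists m : nat, v < u (n + m%:Z).
  exists (Num.truncn (`|v - u n|)).+1.
  apply: lt_le_trans (log_grid_addn _ _).
  rewrite -ltrBlDl; apply: le_lt_trans (ler_norm _) _; exact: truncnS_gt.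
have [k0 k0v] : exists k0, u k0 <= v.
  pose N := (Num.truncn (`|u 0 - v|)).+1.
  exists (- N%:Z); have := log_grid_addn (- N%:Z) N; rewrite addNr => h.
  have : `|u 0 - v| < N%:R by exact: truncnS_gt.
  by have := ler_norm (u 0 - v); lra.
(* The least number of steps from [k0] that leads beyond [v] is not 0, since [u k0 <= v]; the index
   just before it is the wanted one. *)
case: (ex_minnP (ex k0)) => -[|m] hm mmin.
  by move: hm; rewrite addr0 ltNge k0v.
exists (k0 + m%:Z); rewrite -addrA intS (addrC 1) addrA in hm *.
apply/andP; split; last by [].
by rewrite leNgt; apply/negP => /mmin; rewrite ltnn.
Qed.

Definition log_cell (k : int) : set R := `[expR (u k), expR (u (k + 1))[.

Lemma log_cellP k s : 0 < s -> log_cell k s <-> u k <= ln s < u (k + 1).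
Proof.
move=> s0; rewrite /log_cell /= in_itv/=.
by rewrite -{1 2}(lnK (x := s)) ?posrE// ler_expR ltr_expR.
Qed.

Lemma log_cell_gt0 k s : log_cell k s -> 0 < s.
Proof. by rewrite /log_cell /= in_itv/= => /andP[+ _]; apply: lt_le_trans; exact: expR_gt0.
    Qed.

Lemma log_cell_triv : trivIset setT (fun n => log_cell (int_enum n)).
Proof.
have [_ inj _] := int_enum_bij.
move=> m n _ _ [s [sm sn]]; apply: inj; rewrite ?inE//.
have s0 := log_cell_gt0 sm.
move/(log_cellP _ s0) : sm => /andP[m1 m2]; move/(log_cellP _ s0) : sn => /andP[n1 n2].
have [h|h|//] := ltgtP (int_enum m) (int_enum n).
- by exfalso; have := log_grid_lt h; lra.
- by exfalso; have := log_grid_lt h; lra.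
Qed.

Lemma log_cell_measure k : mu (log_cell k) = (expR (u (k + 1)) - expR (u k))%:E.
Proof.
rewrite /log_cell completed_measure_itv /= lte_fin ltr_expR ifT//.
by apply: lt_le_trans (u1 k); rewrite ltrDl.
Qed.

Lemma log_cell_measurable k : measurable (log_cell k : set T).
Proof. by apply: lebesgue_measurable_sub; exact: measurable_itv. Qed.

(** On cell k the density [s^-1] is at most exp(- u k), and the length of the cell is at most exp(M
    + u k); hence the factor [expR M]. *)
Lemma haar_int_ub (p : R) (F : R -> R) (y : int -> R) : 0 < p ->
  (forall s, 0 < s -> 0 <= F s) ->
  (forall k, 0 <= y k) -> (forall k s, log_cell k s -> F s <= y k) ->
  (haar_int p `]0%R, +oo[ F <= (expR M)%:E * \sum_(n <oo) (y (int_enum n) `^ p)%:E)%E.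
Proof.
move=> p0 F0 y0 Fy.
have z0 n : 0 <= expR (- u (int_enum n)) * y (int_enum n) `^ p.
  by rewrite mulr_ge0 ?expR_ge0 ?powR_ge0.
apply: (le_trans (@lower_integral_step_ub _ _ _ mu
  (fun n => log_cell (int_enum n)) (fun n => expR (- u (int_enum n)) * y (int_enum n) `^ p) _
      _ z0 _ _)).
- by move=> n; exact: log_cell_measurable.
- move=> x; apply: erestrict_ge0 => s /=; rewrite in_itv/= andbT => s0.
  by rewrite lee_fin mulr_ge0 ?powR_ge0 ?invr_ge0 ?ltW.
- move=> s; rewrite /patch; case: ifPn => [/set_mem|_]; last by left.
  rewrite /= in_itv/= andbT => s0; right.
  have [k kP] := log_grid_cover (ln s).
  have [_ _ /(_ k I)[n _ nk]] := int_enum_bij.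
  have sk : log_cell k s by apply/log_cellP.
  exists n; rewrite nk// lee_fin; apply: ler_pM; rewrite ?invr_ge0 ?powR_ge0 ?(ltW s0)//.
    rewrite expRN lef_pV2 ?posrE ?expR_gt0//.
    by rewrite -[leRHS]lnK ?posrE// ler_expR; case/andP : kP.
  by apply: ge0_ler_powR; rewrite ?nnegrE ?(ltW p0) ?y0 ?F0//; exact: Fy.
- rewrite -nneseriesZl; last by move=> n _; rewrite lee_fin powR_ge0.
  apply: lee_nneseries => n _; first by rewrite mule_ge0 ?lee_fin ?z0.
  rewrite [X in (_ * X)%E]log_cell_measure -!EFinM lee_fin mulrAC; apply: ler_wpM2r; first
      exact: powR_ge0.
  rewrite mulrBr -!expRD addNr expR0 lerBlDr; apply: (@le_trans _ _ (expR M)); last by rewrite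
      lerDl.
  by rewrite ler_expR; have := uM (int_enum n); lra.
Qed.

(** On cell k the density is at least exp(- u (k + 1)). Times the length of the cell this is at
    least 1 - exp(-1), hence at least 1/2. *)
Lemma haar_int_lb (p : R) (F : R -> R) (y : int -> R) : 0 < p ->
  (forall s, 0 < s -> 0 <= F s) ->
  (forall k, 0 <= y k) -> (forall k s, log_cell k s -> y k <= F s) ->
  (\sum_(n <oo) (y (int_enum n) `^ p)%:E <= 2%:E * haar_int p `]0%R, +oo[ F)%E.
Proof.
move=> p0 F0 y0 Fy.
have z0 n : 0 <= expR (- u (int_enum n + 1)) * y (int_enum n) `^ p.
  by rewrite mulr_ge0 ?expR_ge0 ?powR_ge0.
rewrite -lee_pdivrMl//.
apply: (le_trans _ (@lower_integral_step_lb _ _ _ mu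
  (fun n => log_cell (int_enum n)) (fun n => expR (- u (int_enum n + 1)) * y (int_enum n) `^
      p) _ _ z0 _ log_cell_triv _)).
- rewrite -nneseriesZl; last by move=> n _; rewrite lee_fin powR_ge0.
  apply: lee_nneseries => n _; first by rewrite mule_ge0 ?lee_fin ?powR_ge0 ?invr_ge0.
  rewrite [X in (_ <= _ * X)%E]log_cell_measure -!EFinM lee_fin [leRHS]mulrAC; apply:
      ler_wpM2r; first exact: powR_ge0.
  rewrite mulrBr -!expRD addNr expR0.
  have : expR (- u (int_enum n + 1) + u (int_enum n)) <= expR (-1) :> R.
    by rewrite ler_expR; have := u1 (int_enum n); lra.
  have : expR (- 1) <= 2^-1 :> R.
    by rewrite expRN lef_pV2 ?posrE ?expR_gt0//; have := expR_ge1Dx (1 : R).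
  by lra.
- by move=> n; exact: log_cell_measurable.
- move=> x; apply: erestrict_ge0 => s /=; rewrite in_itv/= andbT => s0.
  by rewrite lee_fin mulr_ge0 ?powR_ge0 ?invr_ge0 ?ltW.
- move=> n s sn; have s0 := log_cell_gt0 sn.
  rewrite /patch mem_set/= ?in_itv/= ?s0// lee_fin.
  apply: ler_pM; rewrite ?invr_ge0 ?powR_ge0 ?expR_ge0//.
    rewrite expRN lef_pV2 ?posrE ?expR_gt0//.
    by move: sn; rewrite /log_cell/= in_itv/= => /andP[_ /ltW].
  by apply: ge0_ler_powR; rewrite ?nnegrE ?(ltW p0) ?y0 ?F0//; exact: Fy.
Qed.

End Discretization.

Section NormBounds.
Variable R : realType.
Implicit Types (q : \bar R) (D : set R) (F G : R -> R).
Local Notation T := (lebesgue_measurableType R).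
Local Notation mu := (@completed_lebesgue_measure R : {measure set T -> \bar R}).

(** [Lnorm] with exponent +oo is the essential supremum only when the whole space has positive
    measure. *)
Lemma completed_measureT_gt0 : (0 < mu [set: R])%E.
Proof.
have : (0 < mu `[0%R, 1%R]%classic)%E.
  by rewrite completed_measure_itv/= lte_fin ltr01 oppr0 adde0 lte_fin ltr01.
move=> /lt_le_trans; apply; apply: le_measure; rewrite ?inE//.
by apply: lebesgue_measurable_sub; exact: measurable_itv.
Qed.

Lemma Lq_haar_pinftyP D F (B : R) : (forall s, D s -> 0 <= F s) -> D `<=` `]0, +oo[ -> 0 <= B
    ->
  (Lq_haar +oo%E D F <= B%:E)%E <-> {ae mu, forall s, D s -> F s <= B}.
Proof.
move=> F0 D0 B0; rewrite /Lq_haar /Lq_norm unlock completed_measureT_gt0.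
have e s : (abse \o (fun s => (s `^ (- qinv +oo%E) * F s)%:E) \_ D) s =
   if s \in D then (F s)%:E else 0%E.
  rewrite /= /patch; case: ifPn => [/set_mem Ds|_]; last by rewrite abse0.
  by rewrite qinvy oppr0 powRr0 mul1r gee0_abs// lee_fin F0.
split=> [/ess_supP|] h; [|apply/ess_supP]; apply: (@filterS _ _ (ae_filter_ringOfSetsType mu))
    h => s.
- by rewrite e => h Ds; rewrite mem_set// lee_fin in h.
- by rewrite e; case: ifPn => [/set_mem Ds /(_ Ds)|_ _]; rewrite lee_fin.
Qed.

Lemma Lq_haar_kernel q (e : R) : (0 < q)%E -> 0 < e -> exists2 C : R, 0 < C & forall t, 0 < t
    ->
  (Lq_haar q `]0%R, +oo[ (fun s => expR (- e * `|ln s - ln t|))%R <= C%:E)%E.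
Proof.
case: q => [p||//]; rewrite ?lte_fin => p0 e0; last first.
  exists 1 => // t t0; apply/Lq_haar_pinftyP => //.
    apply: aeW => s _; rewrite -expR0 ler_expR mulNr oppr_le0 mulr_ge0 ?(ltW e0)//.
have [B B0 HB] := int_sum_kernel (mulr_gt0 e0 p0).
pose K := expR 1 * (expR (e * p) * B).
have K0 : 0 < K by rewrite !mulr_gt0 ?expR_gt0.
exists (K `^ p^-1); first exact: powR_gt0.
move=> t t0; apply/Lq_haar_leP => //; first by rewrite powR_ge0.
rewrite -powRrM mulVf ?gt_eqF// powRr1 ?(ltW K0)//.
(* Centring the grid at [ln t] uses the dilation invariance of ds/s: the bound on cell k depends on
   k alone. The factor [expR e] in [y] accounts for |k| <= |ln s - ln t| + 1 on that cell. *)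
pose u (k : int) := ln t + k%:~R.
pose y (k : int) := expR e * expR (- e * `|k|%N%:R).
have u1 k : u k + 1 <= u (k + 1) by rewrite /u intrD addrA.
have uM k : u (k + 1) <= u k + 1 by rewrite /u intrD addrA.
apply: (le_trans (@haar_int_ub _ u 1 u1 uM p _ y p0 _ _ _)) => //.
- by move=> k; rewrite mulr_ge0.
- move=> k s ks; have s0 := log_cell_gt0 ks.
  move/(log_cellP _ _ s0) : ks; rewrite /u intrD => /andP[h1 h2].
  rewrite /y -expRD ler_expR.
  have -> : (`|k|%N%:R : R) = `|k%:~R| by rewrite -intr_norm -abszE.
  suff : `|k%:~R| <= `|ln s - ln t| + 1 :> R by move: (`|_|) (`|_|) => x z; nra.
  have -> : k%:~R = (k%:~R - (ln s - ln t)) + (ln s - ln t) by rewrite subrK.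
  apply: (le_trans (ler_normD _ _)); rewrite addrC lerD2l ler_norml; apply/andP; split; lra.
- rewrite /K EFinM lee_pmul2l ?lte_fin ?expR_gt0// EFinM.
  have yE n : (y (int_enum n) `^ p)%:E =
      ((expR (e * p))%:E * (expR (- (e * p) * `|int_enum n - 0|%N%:R))%:E)%E.
    rewrite -EFinM; congr EFin; rewrite subr0 /y -!expRD /powR gt_eqF ?expR_gt0// expRK.
    by congr expR; ring.
  rewrite (eq_eseriesr (fun n _ => yE n)) nneseriesZl; last by move=> n _; rewrite lee_fin.
  by rewrite lee_pmul2l ?lte_fin ?expR_gt0// HB.
Qed.

(** The interval from t to e t has mass 1 for ds/s, whatever t is, so a lower bound on it is a lower
    bound for the norm up to a constant depending on [q] only. *)
Lemma Lq_haar_pointwise q : (0 < q)%E -> exists2 C : R, 0 < C &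
  forall (t c B : R) D F, 0 < t -> `[t, expR 1 * t[ `<=` D -> D `<=` `]0, +oo[ ->
   (forall s, D s -> 0 <= F s) -> 0 <= c ->
   (forall s, t <= s -> s < expR 1 * t -> c <= F s) -> 0 <= B ->
   (Lq_haar q D F <= B%:E)%E -> c <= C * B.
Proof.
have et (t : R) : 0 < t -> t < expR 1 * t.
  by move=> t0; rewrite -{1}(mul1r t) ltr_pM2r// -expR0 ltr_expR.
have mc (t : R) : measurable (`[t, expR 1 * t[%classic : set T).
  by apply: lebesgue_measurable_sub; exact: measurable_itv.
have muc (t : R) : 0 < t -> mu (`[t, expR 1 * t[%classic) = (expR 1 * t - t)%:E.
  by move=> t0; rewrite completed_measure_itv/= lte_fin et.
case: q => [p||//]; rewrite ?lte_fin => p0; last first.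
  exists 1 => // t c B D F t0 tD D0 F0 c0 cF B0; rewrite mul1r => /Lq_haar_pinftyP.
  (* [N] is a null set containing all points of [D] where [F] exceeds [B]. If [B < c] it would
     contain the whole interval, which has positive measure. *)
  move=> /(_ F0 D0 B0) -[N [mN N0 NB]].
  rewrite leNgt; apply/negP => Bc.
  have : (mu `[t, (expR 1 * t)%R[%classic <= mu N)%E.
    apply: le_measure; rewrite ?inE//.
    move=> s hs; apply: NB => /= /(_ (tD _ hs)).
    by move: hs; rewrite /= in_itv/= => /andP[h1 h2]; have := cF _ h1 h2; lra.
  by rewrite N0 muc// lee_fin subr_le0 leNgt et.
exists ((2 * expR 1) `^ p^-1); first by rewrite powR_gt0// mulr_gt0 ?expR_gt0.
move=> t c B D F t0 tD D0 F0 c0 cF B0 /Lq_haar_leP.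
move=> /(_ p0 D0 F0 B0) hB.
have pos : 0 < 2 * expR 1 :> R by rewrite mulr_gt0 ?expR_gt0.
suff h : c `^ p <= 2 * expR 1 * B `^ p.
  have -> : c = (c `^ p) `^ p^-1 by rewrite -powRrM divff ?gt_eqF// powRr1.
  have -> : B = (B `^ p) `^ p^-1 by rewrite -powRrM divff ?gt_eqF// powRr1.
  rewrite -powRM ?powR_ge0 ?(ltW pos)//.
  by apply: ge0_ler_powR; rewrite ?nnegrE ?invr_ge0 ?(ltW p0) ?powR_ge0 ?mulr_ge0 ?powR_ge0
      ?expR_ge0.
(* [z] bounds the integrand from below on the interval, and [z] times the length is c^p (e - 1) / e.
   The factor [2 * expR 1] is enough because 2 (e - 1) >= 1. *)
pose z := (expR 1 * t)^-1 * c `^ p.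
have z0 : 0 <= z by rewrite mulr_ge0 ?powR_ge0 ?invr_ge0 ?mulr_ge0 ?expR_ge0 ?(ltW t0).
have : ((z * (expR 1 * t - t))%:E <= (B `^ p)%:E)%E.
  apply: le_trans hB.
  have -> : ((z * (expR 1 * t - t))%:E =
     \int[mu]_x (z%:E * (\1_(`[t, (expR 1 * t)%R[%classic) x)%:E))%E.
    rewrite ge0_integralZl_EFin//.
    - by rewrite integral_indic// setIT EFinM; congr (_ * _)%E; rewrite [RHS]muc.
    - by apply/measurable_EFinP; exact: measurable_indic.
  apply: le_lower_integral => x; first by rewrite mule_ge0 ?lee_fin.
  rewrite indicE; have [xt|_] := boolP (x \in _); last first.
    rewrite mule0; apply: erestrict_ge0 => s Ds.
    have s0 : 0 < s by have := D0 _ Ds; rewrite /= in_itv/= andbT.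
    by rewrite lee_fin mulr_ge0 ?invr_ge0 ?powR_ge0 ?ltW.
  move/set_mem : xt => xt; rewrite mule1 /patch (mem_set (tD _ xt)) lee_fin.
  have x0 : 0 < x by have := D0 _ (tD _ xt); rewrite /= in_itv/= andbT.
  move: (xt); rewrite /= in_itv/= => /andP[h1 h2].
  apply: ler_pM; rewrite ?invr_ge0 ?mulr_ge0 ?powR_ge0 ?expR_ge0 ?(ltW t0)//.
    by rewrite lef_pV2 ?posrE ?mulr_gt0 ?expR_gt0// ltW.
  apply: ge0_ler_powR; rewrite ?nnegrE ?(ltW p0) ?F0//; [exact: tD|exact: cF].
rewrite lee_fin /z => h.
rewrite -[leRHS]mulrA [expR 1 * _]mulrC mulrA -ler_pdivrMr ?expR_gt0//.
apply: (le_trans _ (ler_wpM2l (ler0n _ 2) h)).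
have E1 : 2 <= expR 1 :> R by have := expR_ge1Dx (1 : R).
have -> : 2 * ((expR 1 * t)^-1 * c `^ p * (expR 1 * t - t)) =
  c `^ p / expR 1 * (2 * (expR 1 - 1)).
  by field; rewrite !gt_eqF ?expR_gt0.
by rewrite ler_peMr ?mulr_ge0 ?powR_ge0 ?invr_ge0 ?expR_ge0//; lra.
Qed.

Lemma leb_measurable_Borel D F :
  measurable_fun [set: measurableTypeR R] (F : measurableTypeR R -> measurableTypeR R) ->
  leb_measurable D F.
Proof.
move=> mF mD Y mY; apply: measurableI => //; apply: lebesgue_measurable_sub.
by rewrite -[_ @^-1` _]setTI; exact: mF.
Qed.

(** The splitting uses additivity for measurable integrands. It is applied to the product of a
    slowly varying function with [damp], which is measurable. *)
Lemma Lq_haar_setU q : (0 < q)%E -> exists2 C : R, 0 < C &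
  forall (B : R) D1 D2 F, measurable (D1 : set T) -> measurable (D2 : set T) ->
   [disjoint D1 & D2] -> D1 `|` D2 `<=` `]0, +oo[ -> leb_measurable (D1 `|` D2) F ->
   (forall s, (D1 `|` D2) s -> 0 <= F s) -> 0 <= B ->
   (Lq_haar q D1 F <= B%:E)%E -> (Lq_haar q D2 F <= B%:E)%E -> (Lq_haar q (D1 `|` D2) F <= (C
       * B)%:E)%E.
Proof.
case: q => [p||//]; rewrite ?lte_fin => p0; last first.
  exists 1 => // B D1 D2 F _ _ _ D0 _ F0 B0; rewrite mul1r.
  have D10 : D1 `<=` `]0, +oo[ by move=> s sD; apply: D0; left.
  have D20 : D2 `<=` `]0, +oo[ by move=> s sD; apply: D0; right.
  move=> /Lq_haar_pinftyP h1 /Lq_haar_pinftyP h2; apply/Lq_haar_pinftyP => //.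
  have {}h1 := h1 (fun s sD => F0 s (or_introl sD)) D10 B0.
  have {}h2 := h2 (fun s sD => F0 s (or_intror sD)) D20 B0.
  by apply: (@filterS2 _ _ (ae_filter_ringOfSetsType mu)) h1 h2 => s h1 h2 [/h1|/h2].
exists (2 `^ p^-1); first by rewrite powR_gt0.
move=> B D1 D2 F mD1 mD2 dis D0 mF F0 B0.
have D10 : D1 `<=` `]0, +oo[ by move=> s sD; apply: D0; left.
have D20 : D2 `<=` `]0, +oo[ by move=> s sD; apply: D0; right.
move=> /(Lq_haar_leP p0 D10 (fun s sD => F0 s (or_introl sD)) B0) h1.
move=> /(Lq_haar_leP p0 D20 (fun s sD => F0 s (or_intror sD)) B0) h2.
apply/Lq_haar_leP => //; first by rewrite mulr_ge0 ?powR_ge0.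
rewrite powRM ?powR_ge0// -powRrM mulVf ?gt_eqF// powRr1//.
rewrite /haar_int -integral_mkcond ge0_integral_setU//.
- rewrite [X in (X + _ <= _)%E]integral_mkcond [X in (_ + X <= _)%E]integral_mkcond.
  by rewrite mulrDl mul1r EFinD; exact: leeD.
- apply/measurable_EFinP; apply: measurable_funM.
    apply: (@eq_measurable_fun _ _ T _ _ (fun x => x `^ (-1))).
      move=> x /set_mem Dx; rewrite powR_inv1//.
      by have := D0 _ Dx; rewrite /= in_itv/= andbT => /ltW.
    by apply: leb_measurable_Borel => //; exact: measurable_powR.
  apply: (measurableT_comp (measurable_powR _)); exact: mF.
- move=> x Dx; have x0 : 0 < x by have := D0 _ Dx; rewrite /= in_itv/= andbT.
  by rewrite lee_fin mulr_ge0 ?powR_ge0 ?invr_ge0 ?ltW.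
Qed.

End NormBounds.

(** * The functions c0 and c1 *)

Section CumulativeNorm.
Variable R : realType.
Local Notation T := (lebesgue_measurableType R).

Variables (r : \bar R) (b : R -> R).
Hypotheses (r0 : (0 < r)%E) (bRV : RV 0 b) (mb : leb_measurable `]0, +oo[ b).

Let b0 s : 0 < s -> 0 < b s. Proof. exact: (RV_gt0 bRV). Qed.

Definition cum (t : R) : R := fine (Lq_haar r `]0, t[ b).

(** For positive [k], [s] and [t] this is min(1, (t/s)^k): it leaves the part below [t] untouched
    and makes a slowly varying function integrable for ds/s at infinity. *)
Definition damp (k t s : R) : R := expR (- k * Num.max 0 (ln s - ln t)).

Lemma damp_near k t s : 0 < s -> s <= t -> damp k t s = 1.
Proof.
move=> s0 st; rewrite /damp max_l ?mulr0 ?expR0// subr_le0 ler_ln ?posrE//.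
exact: lt_le_trans s0 st.
Qed.

Lemma damp_far k t s : 0 < t -> t <= s -> damp k t s = expR (- k * `|ln s - ln t|).
Proof.
move=> t0 ts; have h : 0 <= ln s - ln t.
  by rewrite subr_ge0 ler_ln ?posrE// (lt_le_trans t0).
by rewrite /damp max_r// ger0_norm.
Qed.

Lemma damp_ge0 k t s : 0 <= damp k t s. Proof. exact: expR_ge0. Qed.

(** Beyond [t], half of the damping absorbs the growth of [b] and the other half is integrable. The
    bound is an arbitrary [B] instead of [cum t], because the first use, at t = 1, serves to prove
    that the norms defining [cum] are finite. *)
Lemma Lq_haar_damp (k C1 : R) : 0 < k -> 0 < C1 -> exists2 C : R, 0 < C & forall t B : R,
  0 < t -> b t <= C1 * B -> (Lq_haar r `]0%R, t[ b <= B%:E)%E ->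
  (Lq_haar r `]0%R, +oo[ (fun s => b s * damp k t s)%R <= (C * B)%:E)%E.
Proof.
move=> k0 C10; have k20 : 0 < k / 2 by rewrite divr_gt0.
have [C2 C20 H2] := Lq_haar_kernel r0 k20.
have [C3 C30 H3] := RV_le bRV k20.
have [C4 C40 H4] := Lq_haar_setU r0.
pose K := 1 + C3 * C1 * C2; have K0 : 0 < K by rewrite ltr_wpDr// !mulr_ge0 ?ltW.
exists (C4 * K); first by rewrite mulr_gt0.
move=> t B t0 bB wB; have B0 : 0 < B.
  by rewrite -(pmulr_rgt0 _ C10); exact: lt_le_trans (b0 t0) bB.
have DU : `]0, +oo[%classic = `]0, t[%classic `|` `[t, +oo[%classic :> set R.
  apply/seteqP; split=> s /=; rewrite !in_itv/= !andbT.
    by move=> s0; have [ts|st] := leP t s; [right|left; rewrite s0].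
  by case=> [/andP[]//|]; exact: lt_le_trans.
have Fge0 s : 0 < s -> 0 <= b s * damp k t s.
  by move=> s0; rewrite mulr_ge0 ?damp_ge0 ?ltW ?b0.
have sub1 : (`]0, t[%classic : set R) `<=` `]0, +oo[ by rewrite DU; left.
have sub2 : (`[t, +oo[%classic : set R) `<=` `]0, +oo[ by rewrite DU; right.
have pos s : (`]0, +oo[%classic : set R) s -> 0 < s by rewrite /= in_itv/= andbT.
rewrite -mulrA DU; apply: H4.
- by apply: lebesgue_measurable_sub; exact: measurable_itv.
- by apply: lebesgue_measurable_sub; exact: measurable_itv.
- rewrite disj_set2E; apply/eqP/seteqP; split=> // s /= []; rewrite !in_itv/= andbT.
  by move=> /andP[_ +] /(lt_le_trans _) h => /h; rewrite ltxx.
- by rewrite -DU.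
- rewrite -DU; apply: measurable_funM; first exact: mb.
  apply: leb_measurable_Borel.
  apply: measurableT_comp => //; apply: measurable_funM => //.
  by apply: measurable_maxr => //; apply: measurable_funB => //; exact: measurable_ln.
- by rewrite -DU => s /pos; exact: Fge0.
- by rewrite mulr_ge0 ?ltW.
- apply: (@le_trans _ _ (1 * B)%:E); last first.
    by rewrite lee_fin ler_pM2r// lerDl !mulr_ge0 ?ltW.
  apply: (@Lq_haar_bound _ _ _ `]0, t[ _ b) => //.
  + by move=> s /sub1/pos; exact: Fge0.
  + by move=> s /sub1/pos s0; rewrite ltW ?b0.
  + move=> s hs; have s0 := pos _ (sub1 _ hs).
    move: hs; rewrite /= in_itv/= => /andP[_ /ltW st].
    by rewrite damp_near// mulr1 mul1r.
- apply: (@le_trans _ _ ((C3 * b t) * C2)%:E); last first.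
    rewrite lee_fin -mulrA; apply: (@le_trans _ _ (C3 * C1 * C2 * B)); last first.
      by rewrite ler_pM2r// lerDr.
    by rewrite -!mulrA ler_pM2l// [C2 * B]mulrC mulrA ler_pM2r.
  apply: (Lq_haar_bound _ _ sub2 _ _ _ (H2 _ t0)) => //.
  + by rewrite mulr_gt0 ?b0.
  + by move=> s /sub2/pos; exact: Fge0.
  + move=> s hs; have s0 := pos _ (sub2 _ hs).
    move: hs; rewrite /= in_itv/= andbT => ts.
    rewrite damp_far//; have := H3 s t s0 t0; rewrite mul0r add0r.
    move=> h; apply: (le_trans (ler_wpM2r (expR_ge0 _) h)).
    have -> : expR (- (k / 2) * `|ln s - ln t|) =
        expR (k / 2 * `|ln s - ln t|) * expR (- k * `|ln s - ln t|).
      by rewrite -expRD; congr expR; field.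
    by rewrite le_eqVlt; apply/orP; left; apply/eqP; ring.
Qed.

Hypothesis fin1 : (Lq_haar r `]0%R, 1%R[ b < +oo)%E.

Let cum_ub0 t : (Lq_haar r `]0%R, t[ b < +oo)%E -> Lq_haar r `]0, t[ b = (cum t)%:E.
Proof. by move=> h; rewrite /cum fineK// ge0_fin_numE ?Lq_haar_ge0. Qed.

(** Finiteness is assumed on (0,1) only. The damped norm centred at 1 is finite over the whole
    half-line, and [damp 1 1] is bounded below on (0,t); so [fine] loses nothing in [cum]. *)
Lemma Lq_haar_cum t : 0 < t -> Lq_haar r `]0, t[ b = (cum t)%:E.
Proof.
move=> t0; apply: cum_ub0.
have [C C0 HC] := Lq_haar_damp (k := 1) (C1 := 1) ltr01 ltr01.
have B0 : 0 <= cum 1 by rewrite fine_ge0 ?Lq_haar_ge0.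
have := HC 1 (b 1 + cum 1) ltr01.
rewrite mul1r lerDl B0 (cum_ub0 fin1) lee_fin lerDr ltW ?b0// => /(_ isT isT) h.
apply: (@le_lt_trans _ _ (expR (1 * Num.max 0 (ln t - ln 1)) * (C * (b 1 + cum 1)))%:E); last
    exact: ltry.
have sub : (`]0, t[%classic : set R) `<=` `]0, +oo[.
  by move=> s /=; rewrite !in_itv/= andbT => /andP[].
have pos s : (`]0, +oo[%classic : set R) s -> 0 < s by rewrite /= in_itv/= andbT.
apply: (Lq_haar_bound r0 (expR_gt0 _) sub _ _ _ h).
- by move=> s /sub/pos s0; rewrite ltW ?b0.
- by move=> s /pos s0; rewrite mulr_ge0 ?damp_ge0 ?ltW ?b0.
- move=> s hs; have s0 := pos _ (sub _ hs).
  rewrite mulrCA ler_pMr ?b0// /damp -expRD -[leLHS]expR0 ler_expR mulNr !mul1r subr_ge0.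
  rewrite ge_max !le_max lexx /= lerD2r ler_ln ?posrE// orbC ltW//.
  by move: hs; rewrite /= in_itv/= => /andP[].
Qed.

Lemma cum_ge0 t : 0 <= cum t.
Proof. by rewrite fine_ge0 ?Lq_haar_ge0. Qed.

(** On [t/e, t) slow variation keeps [b] comparable with [b t], and this interval has mass 1 for
    ds/s. *)
Lemma le_cum : exists2 C : R, 0 < C & forall t, 0 < t -> b t <= C * cum t.
Proof.
have [C C0 HC] := Lq_haar_pointwise r0.
have [C2 C20 H2] := RV_le bRV ltr01.
exists (C2 * expR 1 * C) => [|t t0]; first by rewrite !mulr_gt0 ?expR_gt0.
have te0 : 0 < t / expR 1 by rewrite divr_gt0 ?expR_gt0.
have tee : expR 1 * (t / expR 1) = t by rewrite mulrC divfK// gt_eqF ?expR_gt0.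
have sub : (`]0, t[%classic : set R) `<=` `]0, +oo[.
  by move=> s /=; rewrite !in_itv/= andbT => /andP[].
rewrite -[leRHS]mulrA -ler_pdivrMl; last by rewrite mulr_gt0 ?expR_gt0.
apply: (HC _ _ _ `]0, t[%classic b te0) => //.
- by rewrite tee => s /=; rewrite !in_itv/= => /andP[h ->]; rewrite (lt_le_trans te0 h).
- by move=> s /sub; rewrite /= in_itv/= andbT => s0; rewrite ltW ?b0.
- by rewrite mulr_ge0 ?ltW ?b0// invr_gt0 mulr_gt0 ?expR_gt0.
- rewrite tee => s ts st; have s0 := lt_le_trans te0 ts.
  rewrite ler_pdivrMl ?mulr_gt0 ?expR_gt0//.
  apply: (le_trans (H2 t s t0 s0)); rewrite ler_pM2r ?b0// ler_pM2l// ler_expR.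
  rewrite mul0r add0r mul1r ger0_norm ?subr_ge0 ?ler_ln ?posrE ?(ltW st)//.
  rewrite lerBlDr -[X in X + _](@expRK R) -lnM ?posrE ?expR_gt0// ler_ln ?posrE ?mulr_gt0
      ?expR_gt0//.
  by rewrite -ler_pdivrMl ?expR_gt0// mulrC.
- exact: cum_ge0.
- by rewrite Lq_haar_cum.
Qed.

Lemma cum_gt0 t : 0 < t -> 0 < cum t.
Proof.
move=> t0; have [C C0 H] := le_cum.
by rewrite -(pmulr_rgt0 _ C0); exact: lt_le_trans (b0 t0) (H _ t0).
Qed.

Lemma Lq_haar_damp_cum (k : R) : 0 < k -> exists2 C : R, 0 < C & forall t, 0 < t ->
  (Lq_haar r `]0%R, +oo[ (fun s => b s * damp k t s)%R <= (C * cum t)%:E)%E.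
Proof.
move=> k0; have [C1 C10 H1] := le_cum.
have [C C0 H] := Lq_haar_damp k0 C10; exists C => // t t0.
by apply: H => //; [exact: H1|rewrite Lq_haar_cum].
Qed.

(** [cum] is nondecreasing by inclusion of the intervals. For its growth from [s] to [t], note that
    [damp e s] is at least (s/t)^e on (0,t), and that the norm damped at [s] is at most a multiple
    of [cum s]. *)
Lemma cum_RV : RV 0 cum.
Proof.
split=> [t|e e0]; first exact: cum_gt0.
have [C C0 H] := Lq_haar_damp_cum e0; exists `|ln C|.
have pos s : (`]0, +oo[%classic : set R) s -> 0 < s by rewrite /= in_itv/= andbT.
suff K s t : 0 < s -> s <= t -> `|ln (cum s) - ln (cum t)| <= `|ln C| + e * `|ln s - ln t|.
  move=> s t s0 t0; rewrite mul0r subr0; have [st|/ltW ts] := leP s t; first exact: K.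
  by rewrite distrC (distrC (ln s)); exact: K.
move=> s0 st; have t0 := lt_le_trans s0 st.
have st' : ln s <= ln t by rewrite ler_ln ?posrE.
have sub (u : R) : (`]0, u[%classic : set R) `<=` `]0, +oo[.
  by move=> v /=; rewrite !in_itv/= andbT => /andP[].
have h1 : cum s <= cum t.
  rewrite -lee_fin -!Lq_haar_cum// [X in (_ <= X)%E]Lq_haar_cum// -(mul1r (cum t)).
  apply: (@Lq_haar_bound _ _ _ `]0, t[ _ b) => //.
  - by move=> v /=; rewrite !in_itv/= => /andP[-> /lt_le_trans]; apply.
  - by move=> v /sub/pos v0; rewrite ltW ?b0.
  - by move=> v /sub/pos v0; rewrite ltW ?b0.
  - by move=> v _; rewrite mul1r.
  - by rewrite Lq_haar_cum.
have h2 : cum t <= expR (e * (ln t - ln s)) * (C * cum s).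
  rewrite -lee_fin -Lq_haar_cum//.
  apply: (Lq_haar_bound r0 (expR_gt0 _) (@sub t) _ _ _ (H _ s0)).
  - by move=> v /sub/pos v0; rewrite ltW ?b0.
  - by move=> v /pos v0; rewrite mulr_ge0 ?damp_ge0 ?ltW ?b0.
  - move=> v hv; have v0 := pos _ (sub _ _ hv).
    rewrite mulrCA ler_pMr ?b0// /damp -expRD -[leLHS]expR0 ler_expR mulNr -mulrBr.
    rewrite mulr_ge0 ?(ltW e0)// subr_ge0 ge_max subr_ge0 st' /= lerD2r ler_ln ?posrE// ltW//.
    by move: hv; rewrite /= in_itv/= => /andP[].
move: h1 h2; rewrite -ler_ln ?posrE ?cum_gt0// => h1.
rewrite -ler_ln ?posrE ?mulr_gt0 ?cum_gt0 ?expR_gt0//.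
rewrite lnM ?posrE ?mulr_gt0 ?cum_gt0 ?expR_gt0// expRK lnM ?posrE ?cum_gt0// => h2.
rewrite distrC (distrC (ln s)) (ger0_norm (x := ln (cum t) - _)) ?subr_ge0//.
rewrite (ger0_norm (x := ln t - _)) ?subr_ge0//.
by have := ler_norm (ln C); lra.
Qed.

End CumulativeNorm.

(** * Equivalence of norms after the change of variable rho *)

Section Transfer.
Variable R : realType.
Implicit Types (q : \bar R) (F G H : R -> R).

(** Multiplicative, unlike the logarithmic [RV], because K(t, f) may vanish. One pair [A], [C]
    serves all f. *)
Definition moderate (A C : R) F : Prop := forall s t, 0 < s -> 0 < t ->
  0 <= F s /\ F s <= C * expR (A * `|ln s - ln t|) * F t.

Lemma moderate_le A C F (M s t : R) : 0 <= A -> 0 <= C -> moderate A C F ->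
  0 < s -> 0 < t -> `|ln s - ln t| <= M -> F s <= C * expR (A * M) * F t.
Proof.
move=> A0 C0 mF s0 t0 stM; have [_ h] := mF _ _ s0 t0; have [Ft _] := mF _ _ t0 t0.
apply: (le_trans h); apply: ler_wpM2r => //; apply: ler_wpM2l => //.
by rewrite ler_expR ler_wpM2l.
Qed.

Lemma pos_itv (s : R) : (`]0, +oo[%classic : set R) s -> 0 < s.
Proof. by rewrite /= in_itv/= andbT. Qed.

(** A moderate function keeps its size on [t, e t), so each L_q norm for ds/s controls its supremum.
    This settles exponent +oo and puts f in the sum of the end spaces. *)
Lemma moderate_pointwise q (A C0 : R) : (0 < q)%E -> 0 <= A -> 0 < C0 ->
  exists2 C : R, 0 < C & forall F (B t : R), moderate A C0 F -> 0 <= B ->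
   (Lq_haar q `]0%R, +oo[ F <= B%:E)%E -> 0 < t -> F t <= C * B.
Proof.
move=> q0 A0 C00; have [C C_0 HC] := Lq_haar_pointwise q0.
pose K := C0 * expR (A * 1); have K0 : 0 < K by rewrite mulr_gt0 ?expR_gt0.
exists (K * C) => [|F B t mF B0 FB t0]; first by rewrite mulr_gt0.
have F0 s : 0 < s -> 0 <= F s by move=> s0; have [] := mF _ _ s0 s0.
rewrite -[leRHS]mulrA -ler_pdivrMl//.
apply: (HC _ _ _ _ F t0 _ (@subset_refl _ _) _ _ _ B0 FB).
- by move=> s /=; rewrite !in_itv/= andbT => /andP[h _]; exact: lt_le_trans t0 h.
- by move=> s /pos_itv; exact: F0.
- by rewrite mulr_ge0 ?F0// invr_ge0 ltW.
- move=> s ts se; have s0 := lt_le_trans t0 ts.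
  rewrite ler_pdivrMl//; apply: moderate_le => //; first exact: ltW.
  rewrite distrC ger0_norm ?subr_ge0 ?ler_ln ?posrE//.
  rewrite lerBlDr -[X in X + _](@expRK R) -lnM ?posrE ?expR_gt0//.
  by rewrite ler_ln ?posrE ?mulr_gt0 ?expR_gt0// ltW.
Qed.

Variables (rho : R -> R) (ka : R).
Hypotheses (rhoRV : RV ka rho) (ka0 : 0 < ka).

Lemma rho_grid : exists L M : R, [/\ 1 <= L, L <= M,
  forall k : int, ln (rho (expR (L * k%:~R))) + 1 <= ln (rho (expR (L * (k + 1)%:~R))) &
  forall k : int, ln (rho (expR (L * (k + 1)%:~R))) <= ln (rho (expR (L * k%:~R))) + M].
Proof.
have ka20 : 0 < ka / 2 by rewrite divr_gt0.
have [_ /(_ _ ka20)[C HC]] := rhoRV.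
(* Over one step [ln rho] grows by [ka * L] up to an error [C + ka / 2 * L]; this [L] leaves a
   growth of at least 1. *)
pose L := 1 + 2 * (`|C| + 1) / ka.
have L1 : 1 <= L by rewrite lerDl divr_ge0 ?(ltW ka0)// mulr_ge0// addr_ge0.
have kL : ka * L = ka + 2 * (`|C| + 1) by rewrite /L; field; rewrite gt_eqF.
(* The summand [L] lets one [M] bound the gaps of both grids, that of the points and that of their
   images under [rho]. *)
exists L, (L + 2 * ka * L + `|C|).
have D k : ln (expR (L * (k + 1)%:~R)) - ln (expR (L * k%:~R)) = L :> R.
  by rewrite !expRK intrD; ring.
have LC := ler_norm C; have L0 := normr_ge0 C.
have H k := HC (expR (L * (k + 1)%:~R)) (expR (L * k%:~R)) (expR_gt0 _) (expR_gt0 _).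
split=> //.
- by rewrite -addrA lerDl addr_ge0// mulr_ge0 ?mulr_ge0 ?(ltW ka0)// (le_trans ler01).
- move=> k; have := H k; rewrite D (ger0_norm (x := L)) ?(le_trans ler01)//.
  rewrite ler_norml => /andP[h _]; nra.
- move=> k; have := H k; rewrite D (ger0_norm (x := L)) ?(le_trans ler01)//.
  rewrite ler_norml => /andP[_ h]; nra.
Qed.

Lemma cell_dist (u : int -> R) (M : R) (k : int) s :
  u (k + 1) <= u k + M -> log_cell u k s -> `|ln s - u k| <= M.
Proof.
move=> uM hs; have s0 := log_cell_gt0 hs.
by move/(log_cellP _ _ s0) : hs => /andP[h1 h2]; rewrite ger0_norm; lra.
Qed.

(** Stands in for a change of variable: the norm of [G] is bounded by the sum of samples at [x k],
    that of [F] from below by the samples at [rho (x k)], and the hypothesis compares them index by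
    index. *)
Lemma transfer_comp_le (r : \bar R) (A C0 : R) : (0 < r)%E -> 0 <= A -> 0 < C0 ->
  exists2 C : R, 0 < C & forall G F (B : R), moderate A C0 G -> moderate A C0 F ->
   (forall t, 0 < t -> G t <= C0 * F (rho t)) -> 0 <= B ->
   (Lq_haar r `]0%R, +oo[ F <= B%:E)%E -> (Lq_haar r `]0%R, +oo[ G <= (C * B)%:E)%E.
Proof.
move=> r0 A0 C00; have rho0 t : 0 < t -> 0 < rho t by exact: (RV_gt0 rhoRV).
case: r r0 => [p||//] r0; last first.
  (* A bound almost everywhere need not pull back along [rho]; for a moderate function it holds
     everywhere up to a constant. *)
  have [C C_0 HC] := moderate_pointwise r0 A0 C00.
  exists (C0 * C) => [|G F B mG mF GF B0 FB]; first by rewrite mulr_gt0.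
  apply/Lq_haar_pinftyP => //.
  - by move=> s /pos_itv s0; have [] := mG _ _ s0 s0.
  - by rewrite !mulr_ge0 ?(ltW C00) ?(ltW C_0).
  - apply: aeW => s /pos_itv s0; apply: (le_trans (GF _ s0)).
    by rewrite -mulrA ler_pM2l//; apply: HC mF B0 FB _; exact: rho0.
have p0 : 0 < p by rewrite -lte_fin.
have [L [M [L1 LM u1 uM]]] := rho_grid.
have L0 : 0 < L by exact: lt_le_trans L1.
pose x (k : int) := expR (L * k%:~R); have x0 k : 0 < x k by exact: expR_gt0.
pose u k := ln (rho (x k)); pose v (k : int) := ln (x k).
have v1 k : v k + 1 <= v (k + 1) by rewrite /v /x !expRK intrD mulrDr mulr1 lerD2l.
have vM k : v (k + 1) <= v k + M by rewrite /v /x !expRK intrD mulrDr mulr1 lerD2l.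
(* [C'] is the price of moving a moderate function within a cell. It enters [K] twice, once for [G]
   and once for [F]. *)
pose C' := C0 * expR (A * M); have C'0 : 0 < C' by rewrite mulr_gt0 ?expR_gt0.
pose K := C' * C0 * C'; have K0 : 0 < K by rewrite !mulr_gt0 ?expR_gt0.
pose K2 := 2 * expR M * K `^ p; have K20 : 0 < K2 by rewrite !mulr_gt0 ?expR_gt0 ?powR_gt0.
exists (K2 `^ p^-1) => [|G F B mG mF GF B0 FB]; first by rewrite powR_gt0.
have G0 s : 0 < s -> 0 <= G s by move=> s0; have [] := mG _ _ s0 s0.
have F0 s : 0 < s -> 0 <= F s by move=> s0; have [] := mF _ _ s0 s0.
have FB' : (haar_int p `]0%R, +oo[ F <= (B `^ p)%:E)%E.
  by apply/Lq_haar_leP => // s /pos_itv; exact: F0.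
apply/Lq_haar_leP => //; first by move=> s /pos_itv; exact: G0.
  by rewrite mulr_ge0 ?powR_ge0.
rewrite powRM ?powR_ge0// -powRrM mulVf ?gt_eqF// powRr1 ?(ltW K20)//.
pose z k := F (rho (x k)) / C'.
have z0 k : 0 <= z k by rewrite divr_ge0 ?(ltW C'0)// F0// rho0.
have lb : (\sum_(n <oo) (z (int_enum n) `^ p)%:E <= 2%:E * (B `^ p)%:E)%E.
  apply: (le_trans (haar_int_lb (u := u) (F := F) u1 p0 F0 z0 _)); last by rewrite lee_pmul2l.
  move=> k s ks; have s0 := log_cell_gt0 ks.
  rewrite /z ler_pdivrMr// mulrC; apply: moderate_le => //; first exact: ltW.
    exact: rho0.
  by rewrite distrC; apply: cell_dist ks; exact: uM.
apply: (le_trans (haar_int_ub (u := v) (F := G) (y := fun k => K * z k) v1 vM p0 G0 _ _)).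
- by move=> k; rewrite mulr_ge0 ?(ltW K0).
- move=> k s ks; have s0 := log_cell_gt0 ks.
  apply: (le_trans (moderate_le (M := M) A0 (ltW C00) mG s0 (x0 k) _)).
    by apply: (cell_dist (u := v)) ks; exact: vM.
  rewrite -/C'; have -> : K * z k = C' * (C0 * F (rho (x k))).
    by rewrite /K /z; field; rewrite gt_eqF.
  by rewrite ler_pM2l// GF.
- have -> : ((K2 * B `^ p)%:E = (expR M)%:E * ((K `^ p)%:E * (2%:E * (B `^ p)%:E)))%E.
    by rewrite -!EFinM; congr EFin; rewrite /K2; ring.
  rewrite lee_pmul2l ?lte_fin ?expR_gt0//.
  have e n : (((K * z (int_enum n)) `^ p)%:E = (K `^ p)%:E * (z (int_enum n) `^ p)%:E)%E.
    by rewrite powRM ?(ltW K0)// EFinM.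
  rewrite (eq_eseriesr (fun n _ => e n)) nneseriesZl; last by move=> n _; rewrite lee_fin
      powR_ge0.
  by rewrite lee_pmul2l ?lte_fin ?powR_gt0.
Qed.

(* The hypothesis says F(rho t) <= C0 sup_s G(s) exp(-de |ln s - ln t|). On a
   geometric grid the p-th power of this supremum is at most the convolution of
   the sequence G^p with a geometric kernel, which is bounded on l^1. *)
Lemma transfer_sup_le (r : \bar R) (A C0 de : R) : (0 < r)%E -> 0 <= A -> 0 < C0 -> 0 < de ->
  exists2 C : R, 0 < C & forall G F (B : R), moderate A C0 G -> moderate A C0 F ->
   (forall t S, 0 < t -> 0 < S ->
     (forall s, 0 < s -> G s <= S * expR (de * `|ln s - ln t|)) -> F (rho t) <= C0 * S) ->
   0 <= B -> (Lq_haar r `]0%R, +oo[ G <= B%:E)%E -> (Lq_haar r `]0%R, +oo[ F <= (C * B)%:E)%E.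
Proof.
move=> r0 A0 C00 de0; have rho0 t : 0 < t -> 0 < rho t by exact: (RV_gt0 rhoRV).
(* The bounds substituted for [S] below can be 0; adding an arbitrarily small amount extends the
   hypothesis to this case. *)
have wlog0 G F : (forall t S, 0 < t -> 0 < S ->
     (forall s, 0 < s -> G s <= S * expR (de * `|ln s - ln t|)) -> F (rho t) <= C0 * S) ->
   forall t S, 0 < t -> 0 <= S ->
     (forall s, 0 < s -> G s <= S * expR (de * `|ln s - ln t|)) -> F (rho t) <= C0 * S.
  move=> h t S t0 S0 GS; apply/ler_addgt0Pr => e e0.
  have -> : C0 * S + e = C0 * (S + e / C0) by field; rewrite gt_eqF.
  have e'0 : 0 < e / C0 by rewrite divr_gt0.
  apply: h => //; first by rewrite ltr_wpDl.
  by move=> s s0; apply: (le_trans (GS _ s0)); rewrite ler_wpM2r ?expR_ge0// lerDl ltW.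
have [L [M [L1 LM u1 uM]]] := rho_grid.
have L0 : 0 < L by exact: lt_le_trans L1.
pose x (k : int) := expR (L * k%:~R); have x0 k : 0 < x k by exact: expR_gt0.
pose u k := ln (rho (x k)); pose v (k : int) := ln (x k).
have v1 k : v k + 1 <= v (k + 1) by rewrite /v /x !expRK intrD mulrDr mulr1 lerD2l.
have vM k : v (k + 1) <= v k + M by rewrite /v /x !expRK intrD mulrDr mulr1 lerD2l.
pose C' := C0 * expR (A * M); have C'0 : 0 < C' by rewrite mulr_gt0 ?expR_gt0.
have cellF F k s : moderate A C0 F -> log_cell u k s -> F s <= C' * F (rho (x k)).
  move=> mF ks; have s0 := log_cell_gt0 ks.
  apply: moderate_le => //; [exact: ltW|exact: rho0|].
  by apply: (cell_dist (u := u)) ks; exact: uM.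
case: r r0 => [p||//] r0; last first.
  have [C C_0 HC] := moderate_pointwise r0 A0 C00.
  exists (C' * (C0 * C)) => [|G F B mG mF /wlog0 GF B0 GB]; first by rewrite !mulr_gt0
      ?expR_gt0.
  apply/Lq_haar_pinftyP => //.
  - by move=> s /pos_itv s0; have [] := mF _ _ s0 s0.
  - by rewrite !mulr_ge0 ?(ltW C'0) ?(ltW C00) ?(ltW C_0) ?expR_ge0.
  - apply: aeW => s /pos_itv s0.
    have [k /(log_cellP _ _ s0) kP] := log_grid_cover (u := u) u1 (ln s).
    apply: (le_trans (cellF _ _ _ mF kP)); rewrite -mulrA ler_pM2l// -mulrA.
    apply: GF => //; first by rewrite mulr_ge0 ?(ltW C_0).
    move=> y y0; apply: (le_trans (HC _ _ _ mG B0 GB y0)).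
    rewrite ler_peMr ?mulr_ge0 ?(ltW C_0)// -[leLHS]expR0 ler_expR.
    by rewrite mulr_ge0// ltW.
have p0 : 0 < p by rewrite -lte_fin.
have [Q Q0 HQ] := int_sum_kernel (mulr_gt0 de0 p0).
pose K := C' * (C0 * (C' * C' * expR (de * L))).
have K0 : 0 < K by rewrite !mulr_gt0 ?expR_gt0.
pose K2 := expR M * (K `^ p * (Q * 2)).
have K20 : 0 < K2 by rewrite !mulr_gt0 ?expR_gt0 ?powR_gt0.
exists (K2 `^ p^-1) => [|G F B mG mF /wlog0 GF B0 GB]; first by rewrite powR_gt0.
have G0 s : 0 < s -> 0 <= G s by move=> s0; have [] := mG _ _ s0 s0.
have F0 s : 0 < s -> 0 <= F s by move=> s0; have [] := mF _ _ s0 s0.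
have GB' : (haar_int p `]0%R, +oo[ G <= (B `^ p)%:E)%E.
  by apply/Lq_haar_leP => // s /pos_itv; exact: G0.
apply/Lq_haar_leP => //; first by move=> s /pos_itv; exact: F0.
  by rewrite mulr_ge0 ?powR_ge0.
rewrite powRM ?powR_ge0// -powRrM mulVf ?gt_eqF// powRr1 ?(ltW K20)//.
pose y k := G (x k) / C'.
have y0 k : 0 <= y k by rewrite divr_ge0 ?(ltW C'0)// G0.
have lb : (\sum_(n <oo) (y (int_enum n) `^ p)%:E <= 2%:E * (B `^ p)%:E)%E.
  apply: (le_trans (haar_int_lb (u := v) (F := G) v1 p0 G0 y0 _)); last by rewrite lee_pmul2l.
  move=> k s ks; have s0 := log_cell_gt0 ks.
  rewrite /y ler_pdivrMr// mulrC; apply: moderate_le => //; first exact: ltW.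
  by rewrite distrC; apply: cell_dist ks; exact: vM.
pose ker k m : R := expR (- (de * p) * `|k - int_enum m|%N%:R).
have ker0 k m : (0 <= (y (int_enum m) `^ p)%:E * (ker k m)%:E)%E.
  by rewrite mule_ge0 ?lee_fin ?powR_ge0 ?expR_ge0.
(* The convolution of [y]^p with the kernel. It dominates each of its terms, so its root of order p
   can replace the weighted supremum; this works for every p > 0. *)
pose Te k := (\sum_(m <oo) ((y (int_enum m) `^ p)%:E * (ker k m)%:E))%E.
have Te0 k : (0 <= Te k)%E by apply: nneseries_ge0 => m _ _; exact: ker0.
have Tefin k : (Te k < +oo)%E.
  apply: (@le_lt_trans _ _ (2%:E * (B `^ p)%:E)%E); last by rewrite -EFinM ltry.
  apply: le_trans lb; apply: lee_nneseries => m _; first by move=> _; exact: ker0.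
  rewrite -EFinM lee_fin ler_piMr ?powR_ge0// -[leRHS]expR0 ler_expR.
  by rewrite mulNr oppr_le0 !mulr_ge0 ?(ltW de0) ?(ltW p0).
pose t k := fine (Te k).
have tE k : (t k)%:E = Te k by rewrite /t fineK// ge0_fin_numE.
have t0 k : 0 <= t k by rewrite fine_ge0.
have GS k s : 0 < s -> G s <= (C' * C' * expR (de * L)) * t k `^ p^-1 * expR (de * `|ln s - ln
    (x k)|).
  move=> s0; have [j /(log_cellP _ _ s0) js] := log_grid_cover (u := v) v1 (ln s).
  have h1 : G s <= C' * C' * y j.
    apply: (@le_trans _ _ (C' * G (x j))).
      apply: moderate_le => //; first exact: ltW.
      by apply: (cell_dist (u := v)) js; exact: vM.
    by rewrite (_ : C' * C' * y j = C' * G (x j))// /y; field; rewrite gt_eqF.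
  have h2 : y j <= t k `^ p^-1 * expR (de * `|k - j|%N%:R).
    have yE : y j = (y j `^ p) `^ p^-1 by rewrite -powRrM divff ?gt_eqF// powRr1.
    have -> : expR (de * `|k - j|%N%:R) = expR (de * p * `|k - j|%N%:R) `^ p^-1 :> R.
      rewrite /powR gt_eqF ?expR_gt0// expRK; congr expR.
      by field; rewrite gt_eqF.
    rewrite yE -powRM ?expR_ge0//; apply: ge0_ler_powR; rewrite ?invr_ge0 ?(ltW p0)//.
    + by rewrite nnegrE powR_ge0.
    + by rewrite nnegrE mulr_ge0 ?expR_ge0.
    rewrite -ler_pdivrMr ?expR_gt0// -expRN -lee_fin tE.
    have [_ _ /(_ j I)[m _ mj]] := int_enum_bij.
    rewrite /Te nneseries_esumT; last by move=> ?; exact: ker0.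
    apply: esum_ge; exists [set m]; first by split.
    by rewrite fsbig_set1 /ker mj -EFinM mulNr.
  (* Here L |k - j| is at most |ln s - ln (x k)| + L, as [s] lies in cell j; [1 <= L] then removes
     the factor on the left. *)
  have h3 : expR (de * `|k - j|%N%:R) <= expR (de * L) * expR (de * `|ln s - ln (x k)|).
    rewrite -expRD ler_expR -mulrDr ler_pM2l//.
    have -> : (`|k - j|%N%:R : R) = `|(k - j)%:~R| by rewrite -intr_norm -abszE.
    have := cell_dist (u := v) (M := L) (k := j) (s := s).
    have vL : v (j + 1) <= v j + L by rewrite /v /x !expRK intrD mulrDr mulr1.
    move=> /(_ vL js); rewrite /v /x !expRK => h.
    apply: (@le_trans _ _ `|L * (k - j)%:~R|).
      by rewrite normrM (ger0_norm (ltW L0)) ler_peMl.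
    have -> : L * (k - j)%:~R = (ln s - L * j%:~R) - (ln s - L * k%:~R) :> R.
      by rewrite intrB; ring.
    by apply: (le_trans (ler_normB _ _)); rewrite lerD2r.
  have CC : 0 < C' * C' by exact: mulr_gt0.
  have -> : C' * C' * expR (de * L) * t k `^ p^-1 * expR (de * `|ln s - ln (x k)|) =
      C' * C' * (t k `^ p^-1 * (expR (de * L) * expR (de * `|ln s - ln (x k)|))).
    by ring.
  apply: (le_trans h1); rewrite (ler_pM2l CC).
  by apply: (le_trans h2); rewrite ler_wpM2l// powR_ge0.
apply: (le_trans (haar_int_ub (u := u) (F := F) (y := fun k => K * t k `^ p^-1) u1 uM p0 F0 _
    _)).
- by move=> k; rewrite mulr_ge0 ?powR_ge0 ?(ltW K0).
- move=> k s ks; apply: (le_trans (cellF _ _ _ mF ks)).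
  rewrite /K -[leRHS]mulrA ler_pM2l// -[leRHS]mulrA; apply: GF => //; last exact: GS.
  by rewrite !mulr_ge0 ?powR_ge0 ?expR_ge0 ?(ltW C'0) ?(ltW C00).
- have -> : ((K2 * B `^ p)%:E = (expR M)%:E * ((K `^ p)%:E * (Q%:E * (2%:E * (B `^ p)%:E))))%E.
    by rewrite -!EFinM; congr EFin; rewrite /K2; ring.
  rewrite lee_pmul2l ?lte_fin ?expR_gt0//.
  have e n : (((K * t (int_enum n) `^ p^-1) `^ p)%:E = (K `^ p)%:E * Te (int_enum n))%E.
    by rewrite powRM ?powR_ge0 ?(ltW K0)// EFinM -powRrM mulVf ?gt_eqF// powRr1// tE.
  rewrite (eq_eseriesr (fun n _ => e n)) nneseriesZl//.
  (* Tonelli: summed over the cells first, the kernel contributes at most [Q], uniformly in the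
     remaining index. *)
  rewrite lee_pmul2l ?lte_fin ?powR_gt0// /Te nneseries_interchange; last by move=> *; exact:
      ker0.
  apply: (@le_trans _ _ (Q%:E * \sum_(m <oo) (y (int_enum m) `^ p)%:E)%E); last first.
    by rewrite lee_pmul2l ?lte_fin.
  rewrite -nneseriesZl; last by move=> *; rewrite lee_fin powR_ge0.
  apply: lee_nneseries => m _; first by move=> _; apply: nneseries_ge0 => n _ _; exact: ker0.
  rewrite nneseriesZl; last by move=> n _; rewrite lee_fin expR_ge0.
  by rewrite muleC; apply: lee_wpmul2r; [rewrite lee_fin powR_ge0|exact: HQ].
Qed.

End Transfer.

(** * The K-functional *)

Section KFunctional.
Variables (R : realType) (V : lmodType R) (X0 X1 : qspace V).
(** Nonnegativity alone is assumed so that these lemmas apply both to [A0], [A1] and to the two end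
    spaces built from them. *)
Hypotheses (n0 : forall x, carrier X0 x -> 0 <= qnorm X0 x)
  (n1 : forall x, carrier X1 x -> 0 <= qnorm X1 x).

Lemma Kfun_le t f0 f1 : 0 <= t -> carrier X0 f0 -> carrier X1 f1 ->
  Kfun X0 X1 t (f0 + f1) <= qnorm X0 f0 + t * qnorm X1 f1.
Proof.
move=> t0 c0 c1; apply: ge_inf; last by exists f0, f1.
exists 0 => _ [g0 [g1 [d0 d1 _ ->]]].
by rewrite addr_ge0 ?mulr_ge0 ?n0 ?n1.
Qed.

(** Membership in the sum makes the set of costs nonempty; on the empty set [inf] would only return
    its default value. *)
Lemma le_Kfun t f (c : R) : sum_space X0 X1 f ->
  (forall f0 f1, carrier X0 f0 -> carrier X1 f1 -> f = f0 + f1 ->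
     c <= qnorm X0 f0 + t * qnorm X1 f1) -> c <= Kfun X0 X1 t f.
Proof.
move=> [f0 [f1 [c0 c1 fE]]] H; apply: lb_le_inf.
  by exists (qnorm X0 f0 + t * qnorm X1 f1), f0, f1.
by move=> _ [g0 [g1 [d0 d1 gE ->]]]; exact: H.
Qed.

Lemma Kfun_ge0 t f : 0 <= t -> sum_space X0 X1 f -> 0 <= Kfun X0 X1 t f.
Proof.
move=> t0 sf; apply: le_Kfun => // f0 f1 c0 c1 _.
by rewrite addr_ge0 ?mulr_ge0 ?n0 ?n1.
Qed.

Lemma Kfun_lt t f (c : R) : sum_space X0 X1 f -> Kfun X0 X1 t f < c ->
  exists f0 f1, [/\ carrier X0 f0, carrier X1 f1, f = f0 + f1 &
    qnorm X0 f0 + t * qnorm X1 f1 < c].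
Proof.
move=> sf Kc; apply: contrapT => H; move: Kc; rewrite ltNge => /negP; apply.
apply: le_Kfun => // f0 f1 c0 c1 fE; rewrite leNgt; apply/negP => h.
by apply: H; exists f0, f1.
Qed.

Lemma Kfun_nondecreasing s t f : 0 <= s -> s <= t -> sum_space X0 X1 f ->
  Kfun X0 X1 s f <= Kfun X0 X1 t f.
Proof.
move=> s0 st sf; apply: le_Kfun => // f0 f1 c0 c1 ->.
by apply: (le_trans (Kfun_le s0 c0 c1)); rewrite lerD2l ler_wpM2r ?n1.
Qed.

Lemma Kfun_div_nonincreasing s t f : 0 < s -> s <= t -> sum_space X0 X1 f ->
  s * Kfun X0 X1 t f <= t * Kfun X0 X1 s f.
Proof.
move=> s0 st sf; have t0 := lt_le_trans s0 st.
rewrite -ler_pdivrMl//; apply: le_Kfun => // f0 f1 c0 c1 ->.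
rewrite ler_pdivrMl//.
apply: (le_trans (ler_wpM2l (ltW s0) (Kfun_le (ltW t0) c0 c1))).
rewrite !mulrDr; apply: lerD; first by rewrite ler_wpM2r ?n0.
by rewrite !mulrA (mulrC s).
Qed.

Lemma Kfun_moderate s t f : 0 < s -> 0 < t -> sum_space X0 X1 f ->
  Kfun X0 X1 s f <= expR `|ln s - ln t| * Kfun X0 X1 t f.
Proof.
move=> s0 t0 sf; have [st|/ltW ts] := leP s t.
  apply: (le_trans (Kfun_nondecreasing (ltW s0) st sf)).
  by rewrite ler_peMl ?Kfun_ge0 ?(ltW t0)// -[leLHS]expR0 ler_expR.
rewrite ger0_norm ?subr_ge0 ?ler_ln ?posrE// expRB !lnK ?posrE// mulrAC.
by rewrite ler_pdivlMr// mulrC; exact: Kfun_div_nonincreasing.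
Qed.

End KFunctional.

Section QuasiNorm.
Variables (R : realType) (V : lmodType R).
Implicit Types X : qspace V.

Lemma quasinorm0 X : Defs.subspace X -> is_quasinorm X -> qnorm X 0 = 0.
Proof.
move=> [c0 _] [_ _ hZ _]; have := hZ 0 0 c0.
by rewrite scaler0 normr0 mul0r.
Qed.

Lemma subspaceD X x y : Defs.subspace X -> carrier X x -> carrier X y -> carrier X (x + y).
Proof. by move=> [_ h] cx cy; have := h 1 x y cx cy; rewrite scale1r. Qed.

Lemma subspaceN X x : Defs.subspace X -> carrier X x -> carrier X (- x).
Proof. by move=> [c0 h] cx; have := h (-1) x 0 cx c0; rewrite addr0 scaleN1r. Qed.

Lemma quasinormN X x : is_quasinorm X -> carrier X x -> qnorm X (- x) = qnorm X x.
Proof.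
move=> [_ _ hZ _] cx.
by have := hZ (-1) x cx; rewrite scaleN1r normrN1 mul1r.
Qed.

Lemma quasinormD X : is_quasinorm X -> exists2 C : R, 0 < C & forall x y,
  carrier X x -> carrier X y -> qnorm X (x + y) <= C * (qnorm X x + qnorm X y).
Proof.
move=> [hp _ _ [C HC]]; exists (`|C| + 1) => [|x y cx cy]; first by rewrite ltr_pwDr.
apply: (le_trans (HC _ _ cx cy)); apply: ler_wpM2r; first by rewrite addr_ge0 ?hp.
by apply: (le_trans (ler_norm C)); rewrite lerDl.
Qed.

Variables A0 A1 : qspace V.
Hypotheses (sA0 : Defs.subspace A0) (sA1 : Defs.subspace A1)
  (qA0 : is_quasinorm A0) (qA1 : is_quasinorm A1).

Let n0 x : carrier A0 x -> 0 <= qnorm A0 x. Proof. by case: qA0 => + _ _ _; apply. Qed.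
Let n1 x : carrier A1 x -> 0 <= qnorm A1 x. Proof. by case: qA1 => + _ _ _; apply. Qed.

Lemma sum_spaceD f g : sum_space A0 A1 f -> sum_space A0 A1 g -> sum_space A0 A1 (f + g).
Proof.
move=> [f0 [f1 [c0 c1 ->]]] [g0 [g1 [d0 d1 ->]]]; exists (f0 + g0), (f1 + g1).
by split; [exact: subspaceD|exact: subspaceD|rewrite addrACA].
Qed.

Lemma sum_space_left f : carrier A0 f -> sum_space A0 A1 f.
Proof. by move=> cf; exists f, 0; split=> //; [case: sA1|rewrite addr0]. Qed.

Lemma sum_space_right f : carrier A1 f -> sum_space A0 A1 f.
Proof. by move=> cf; exists 0, f; split=> //; [case: sA0|rewrite add0r]. Qed.

Lemma Kfun_left t f : 0 <= t -> carrier A0 f -> Kfun A0 A1 t f <= qnorm A0 f.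
Proof.
move=> t0 cf; have c1 : carrier A1 0 by case: sA1.
have := Kfun_le n0 n1 t0 cf c1.
by rewrite (quasinorm0 sA1 qA1) mulr0 !addr0.
Qed.

Lemma Kfun_right t f : 0 <= t -> carrier A1 f -> Kfun A0 A1 t f <= t * qnorm A1 f.
Proof.
move=> t0 cf; have c0 : carrier A0 0 by case: sA0.
have := Kfun_le n0 n1 t0 c0 cf.
by rewrite (quasinorm0 sA0 qA0) !add0r.
Qed.

Lemma KfunD : exists2 C : R, 0 < C & forall t f g, 0 <= t ->
  sum_space A0 A1 f -> sum_space A0 A1 g ->
  Kfun A0 A1 t (f + g) <= C * (Kfun A0 A1 t f + Kfun A0 A1 t g).
Proof.
have [C0 C00 H0] := quasinormD qA0; have [C1 C10 H1] := quasinormD qA1.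
exists (C0 + C1) => [|t f g t0 sf sg]; first by rewrite addr_gt0.
have C01 : 0 < C0 + C1 by rewrite addr_gt0.
rewrite -ler_pdivrMl// -lerBlDr; apply: le_Kfun => // f0 f1 cf0 cf1 fE.
rewrite lerBlDr -lerBlDl; apply: le_Kfun => // g0 g1 cg0 cg1 gE.
rewrite lerBlDl ler_pdivrMl//.
have -> : f + g = (f0 + g0) + (f1 + g1) by rewrite fE gE addrACA.
apply: (le_trans (Kfun_le n0 n1 t0 (subspaceD sA0 cf0 cg0) (subspaceD sA1 cf1 cg1))).
have h0 := H0 _ _ cf0 cg0; have h1 := ler_wpM2l t0 (H1 _ _ cf1 cg1).
have pf0 := n0 cf0; have pg0 := n0 cg0; have pf1 := n1 cf1; have pg1 := n1 cg1.
apply: (le_trans (lerD h0 h1)); rewrite -subr_ge0.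
have -> : (C0 + C1) * (qnorm A0 f0 + t * qnorm A1 f1 + (qnorm A0 g0 + t * qnorm A1 g1)) -
  (C0 * (qnorm A0 f0 + qnorm A0 g0) + t * (C1 * (qnorm A1 f1 + qnorm A1 g1))) =
  C1 * (qnorm A0 f0 + qnorm A0 g0) + t * (C0 * (qnorm A1 f1 + qnorm A1 g1)) by ring.
by rewrite addr_ge0 ?mulr_ge0 ?addr_ge0 ?(ltW C00) ?(ltW C10).
Qed.

End QuasiNorm.

Lemma SV_div_measurable (R : realType) (b a : R -> R) : SV b -> SV a ->
  leb_measurable `]0, +oo[ (fun s => b s / a s).
Proof.
move=> [_ mb _] [a0 ma _].
apply: (@eq_measurable_fun _ _ (lebesgue_measurableType R) _ _ (fun s => b s * a s `^ (-1))).
  by move=> s /set_mem/pos_itv s0; rewrite powR_inv1// ltW ?a0.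
apply: measurable_funM => //.
by apply: (measurableT_comp (measurable_powR _)).
Qed.

(** * Norm estimates in the two end spaces *)

Section Spaces.
Variables (R : realType) (V : lmodType R) (A0 A1 : qspace V).
Hypotheses (sA0 : Defs.subspace A0) (sA1 : Defs.subspace A1)
  (qA0 : is_quasinorm A0) (qA1 : is_quasinorm A1).

Local Notation K := (Kfun A0 A1).
Local Notation sumA := (sum_space A0 A1).

Let n0 x : carrier A0 x -> 0 <= qnorm A0 x. Proof. by case: qA0 => + _ _ _; apply. Qed.
Let n1 x : carrier A1 x -> 0 <= qnorm A1 x. Proof. by case: qA1 => + _ _ _; apply. Qed.

Let K_ge0 t f : 0 < t -> sumA f -> 0 <= K t f.
Proof. by move=> t0; apply: Kfun_ge0 => //; exact: ltW. Qed.

Lemma interp_normE (X0 X1 : qspace V) (sg : R) (q : \bar R) (b : R -> R) f :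
  interp_norm X0 X1 sg q b f =
  Lq_haar q `]0, +oo[ (fun u => u `^ (- sg) * b u * Kfun X0 X1 u f).
Proof.
apply: eq_Lq_norm => u /pos_itv u0; congr EFin.
by rewrite powRD ?(gt_eqF u0) ?implybT//; ring.
Qed.

Section RSpace.
Variables (sg : R) (r q : \bar R) (b a : R -> R).
Hypotheses (r0 : (0 < r)%E) (q0 : (0 < q)%E) (bSV : SV b) (aSV : SV a).
Let be s := b s / a s.
Hypothesis be_fin : (Lq_haar r `]0%R, 1%R[ be < +oo)%E.

Let a0 s : 0 < s -> 0 < a s. Proof. by case: aSV => + _ _; apply. Qed.
Let b0 s : 0 < s -> 0 < b s. Proof. by case: bSV => + _ _; apply. Qed.
Let be0 s : 0 < s -> 0 < be s. Proof. by move=> s0; rewrite divr_gt0 ?a0 ?b0. Qed.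

Let beRV : RV 0 be.
Proof. by rewrite -(subr0 0); apply: RV_div; exact: SV_RV. Qed.

Let mbe : leb_measurable `]0, +oo[ be.
Proof. exact: SV_div_measurable. Qed.

Let inner f t := Lq_haar q `]t, +oo[ (fun u => u `^ (- sg) * a u * K u f).

Let interpR_normE f : interpR_norm A0 A1 sg r b q a f =
  Lq_norm r `]0, +oo[ (fun t => (t `^ (- qinv r) * be t)%:E * inner f t)%E.
Proof.
apply: eq_Lq_norm => t /pos_itv t0; congr (_ * _)%E.
apply: eq_Lq_norm => u; rewrite /= in_itv/= andbT => tu; congr EFin.
have u0 := lt_trans t0 tu.
by rewrite powRD ?(gt_eqF u0) ?implybT//; ring.
Qed.

(** For every [ta < t] the inner norm sees the interval [t, e t), where its integrand is at least a
    multiple of the value at [t]. The outer norm restricted to (0,t) then supplies [cum r be t]. *)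
Lemma interpR_norm_lower : exists2 C : R, 0 < C & forall f (t B : R),
  sumA f -> 0 < t -> 0 <= B -> (interpR_norm A0 A1 sg r b q a f <= B%:E)%E ->
  t `^ (- sg) * a t * cum r be t * K t f <= C * B.
Proof.
have [C1 C10 H1] := Lq_haar_pointwise q0.
have gRV : RV (- sg) (fun u => u `^ (- sg) * a u).
  by rewrite -[X in RV X _]addr0; apply: RVM; [exact: RV_powR|exact: SV_RV].
have [C2 C20 H2] := RV_le gRV ltr01.
(* Variation of [u^(-sg) a(u)] over a logarithmic distance of at most 1. *)
pose C3 := C2 * expR (`|sg| + 1).
have C30 : 0 < C3 by rewrite mulr_gt0 ?expR_gt0.
exists (C3 * C1) => [|f t B sf t0 B0]; first by rewrite mulr_gt0.
rewrite interpR_normE => NB.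
pose g := t `^ (- sg) * a t * K t f.
have g0 : 0 <= g by rewrite !mulr_ge0 ?powR_ge0 ?K_ge0// ltW ?a0.
have -> : t `^ (- sg) * a t * cum r be t * K t f = g * cum r be t by rewrite /g; ring.
have [->|gn0] := eqVneq g 0; first by rewrite mul0r !mulr_ge0 ?(ltW C30) ?(ltW C20) ?expR_ge0
    ?(ltW C10).
have gp : 0 < g by rewrite lt_neqAle eq_sym gn0.
have Fge0 f' u : sumA f' -> 0 < u -> 0 <= u `^ (- sg) * a u * K u f'.
  by move=> sf' u0; rewrite !mulr_ge0 ?powR_ge0 ?K_ge0// ltW ?a0.
pose g' := (C3 * C1)^-1 * g.
have g'0 : 0 < g' by apply: mulr_gt0 => //; rewrite invr_gt0; exact: mulr_gt0.
have inner_ge ta : 0 < ta -> ta < t -> (g'%:E <= inner f ta)%E.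
  move=> ta0 tat; have := Lq_haar_ge0 q `]ta, +oo[ (fun u => u `^ (- sg) * a u * K u f).
  rewrite -/(inner f ta); case E: (inner f ta) => [B'||]//; rewrite ?leey// !lee_fin => B'0.
  rewrite /g' ler_pdivrMl; last exact: mulr_gt0.
  rewrite -[leRHS]mulrA -ler_pdivrMl//.
  apply: (H1 t _ _ `]ta, +oo[%classic (fun u => u `^ (- sg) * a u * K u f)) => //.
  - by move=> s /=; rewrite !in_itv/= andbT => /andP[+ _]; exact: lt_le_trans.
  - by move=> s /=; rewrite !in_itv/= !andbT; exact: lt_trans.
  - by move=> s; rewrite /= in_itv/= andbT => /(lt_trans ta0); exact: Fge0.
  - by rewrite mulr_ge0 ?invr_ge0 ?(ltW C30).
  - move=> s ts st; have s0 := lt_le_trans t0 ts.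
    rewrite ler_pdivrMl// /g mulrA; apply: ler_pM.
    + by rewrite mulr_ge0 ?powR_ge0 ?ltW ?a0.
    + exact: K_ge0.
    + apply: (le_trans (H2 t s t0 s0)); rewrite ler_wpM2r//.
        by rewrite mulr_ge0 ?powR_ge0 ?ltW ?a0.
      rewrite ler_pM2l// ler_expR mul1r.
      have d1 : `|ln t - ln s| <= 1.
        rewrite distrC ger0_norm ?subr_ge0 ?ler_ln ?posrE//.
        rewrite lerBlDr -[X in X + _](@expRK R) -lnM ?posrE ?expR_gt0//.
        by rewrite ler_ln ?posrE ?mulr_gt0 ?expR_gt0// ltW.
      apply: lerD => //; apply: (le_trans (ler_norm _)).
      by rewrite normrM normrN ler_piMr.
    + exact: (Kfun_nondecreasing n0 n1 (ltW t0)).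
  - by rewrite -/(inner f ta) E.
suff : cum r be t <= g'^-1 * B.
  by rewrite -ler_pdivrMl ?invr_gt0// invrK /g' -mulrA ler_pdivrMl ?mulr_gt0.
have sub : (`]0, t[%classic : set R) `<=` `]0, +oo[.
  by move=> s /=; rewrite !in_itv/= andbT => /andP[].
rewrite -lee_fin -(Lq_haar_cum r0 beRV mbe be_fin t0).
apply: (@Lq_haar_bound _ _ _ `]0, t[ _ (fun s => g' * be s)) => //.
- by rewrite invr_gt0.
- by move=> s /sub/pos_itv s0; rewrite ltW ?be0.
- by move=> s /sub/pos_itv s0; rewrite mulr_ge0 ?ltW ?be0.
- by move=> s _; rewrite mulKf ?gt_eqF.
- apply: le_trans NB; apply: Lq_norm_le => //.
  + by move=> s /sub/pos_itv s0; rewrite lee_fin mulr_ge0 ?powR_ge0//; apply: mulr_ge0;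
      rewrite ltW ?be0.
  + move=> s /pos_itv s0; rewrite mule_ge0 ?Lq_haar_ge0// lee_fin.
    by rewrite mulr_ge0 ?powR_ge0 ?ltW ?be0.
  + move=> s; rewrite /= in_itv/= => /andP[s0 st].
    have -> : s `^ (- qinv r) * (g' * be s) = s `^ (- qinv r) * be s * g' by ring.
    rewrite EFinM; apply: lee_wpmul2l; last exact: inner_ge.
    by rewrite lee_fin mulr_ge0 ?powR_ge0 ?ltW ?be0.
Qed.

(** The decay around [t] is halved: one half makes the inner norm finite, the other is at most
    [damp (ka / 2) t ta] on (ta, +oo) and damps the outer norm. *)
Lemma interpR_norm_upper (ka : R) : 0 < ka -> exists2 C : R, 0 < C & forall f (t Q : R),
  sumA f -> 0 < t -> 0 < Q ->
  (forall u, 0 < u -> u `^ (- sg) * a u * K u f <= Q * expR (- ka * `|ln u - ln t|)) ->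
  (interpR_norm A0 A1 sg r b q a f <= (C * Q * cum r be t)%:E)%E.
Proof.
move=> ka0; have ka20 : 0 < ka / 2 by rewrite divr_gt0.
have [C1 C10 H1] := Lq_haar_kernel q0 ka20.
have [C2 C20 H2] := Lq_haar_damp_cum r0 beRV mbe be_fin ka20.
exists (C1 * C2) => [|f t Q sf t0 Q0 HQ]; first by rewrite mulr_gt0.
have Fge0 u : 0 < u -> 0 <= u `^ (- sg) * a u * K u f.
  by move=> u0; rewrite !mulr_ge0 ?powR_ge0 ?K_ge0// ltW ?a0.
have inner_le ta : 0 < ta -> (inner f ta <= (Q * damp (ka / 2) t ta * C1)%:E)%E.
  move=> ta0.
  have sub : (`]ta, +oo[%classic : set R) `<=` `]0, +oo[.
    by move=> s /=; rewrite !in_itv/= !andbT; exact: lt_trans.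
  apply: (Lq_haar_bound q0 _ sub _ _ _ (H1 _ t0)).
  - by rewrite mulr_gt0 ?expR_gt0.
  - by move=> s /sub/pos_itv; exact: Fge0.
  - by move=> s _; exact: expR_ge0.
  - move=> s hs; have s0 := pos_itv (sub _ hs).
    apply: (le_trans (HQ _ s0)); rewrite -mulrA ler_pM2l// /damp -expRD ler_expR.
    have h : Num.max 0 (ln ta - ln t) <= `|ln s - ln t|.
      rewrite ge_max normr_ge0/=; apply: le_trans (ler_norm _).
      rewrite lerD2r ler_ln ?posrE// ltW//.
      by move: hs; rewrite /= in_itv/= andbT.
    by move: (Num.max _ _) (`|_ - _|) h => x y xy; nra.
have -> : C1 * C2 * Q * cum r be t = Q * C1 * (C2 * cum r be t) by ring.
rewrite interpR_normE.
have QC : 0 < Q * C1 by rewrite mulr_gt0.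
apply: (@le_trans _ _ (Lq_haar r `]0, +oo[ (fun s => Q * C1 * (be s * damp (ka / 2) t s)))).
  apply: Lq_norm_le => //.
  - move=> s /pos_itv s0; rewrite mule_ge0 ?Lq_haar_ge0// lee_fin.
    by rewrite mulr_ge0 ?powR_ge0 ?ltW ?be0.
  - move=> s /pos_itv s0; rewrite lee_fin mulr_ge0 ?powR_ge0// mulr_ge0 ?(ltW QC)//.
    by rewrite mulr_ge0 ?damp_ge0 ?ltW ?be0.
  - move=> s /pos_itv s0.
    have -> : s `^ (- qinv r) * (Q * C1 * (be s * damp (ka / 2) t s)) =
       s `^ (- qinv r) * be s * (Q * damp (ka / 2) t s * C1) by ring.
    rewrite [leRHS]EFinM; apply: lee_wpmul2l; last exact: inner_le.
    by rewrite lee_fin mulr_ge0 ?powR_ge0 ?ltW ?be0.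
apply: (Lq_haar_bound _ _ (@subset_refl _ _) _ _ _ (H2 _ t0)) => //.
- move=> s /pos_itv s0; rewrite mulr_ge0 ?(ltW QC)//.
  by rewrite mulr_ge0 ?damp_ge0 ?ltW ?be0.
- by move=> s /pos_itv s0; rewrite mulr_ge0 ?damp_ge0 ?ltW ?be0.
Qed.

End RSpace.

Section Endpoint.
Variables (r : \bar R) (b : R -> R).
Hypotheses (r0 : (0 < r)%E) (bSV : SV b) (b_fin : (Lq_haar r `]0%R, 1%R[ b < +oo)%E).

Let b0 s : 0 < s -> 0 < b s. Proof. by case: bSV => + _ _; apply. Qed.
Let bRV : RV 0 b. Proof. exact: SV_RV. Qed.
Let mb : leb_measurable `]0, +oo[ b. Proof. by case: bSV. Qed.

(** Since K(s, f)/s >= K(t, f)/t for s < t, the norm restricted to (0,t) is enough, with constant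
    1. *)
Lemma interp1_norm_lower f (t B : R) : sumA f -> 0 < t -> 0 <= B ->
  (interp_norm A0 A1 1 r b f <= B%:E)%E -> t^-1 * cum r b t * K t f <= B.
Proof.
move=> sf t0 B0; rewrite interp_normE => NB.
pose g := t^-1 * K t f.
have g0 : 0 <= g by rewrite mulr_ge0 ?invr_ge0 ?K_ge0 ?ltW.
have -> : t^-1 * cum r b t * K t f = g * cum r b t by rewrite /g; ring.
have [->|gn0] := eqVneq g 0; first by rewrite mul0r.
have gp : 0 < g by rewrite lt_neqAle eq_sym gn0.
rewrite -ler_pdivlMl//.
have sub : (`]0, t[%classic : set R) `<=` `]0, +oo[.
  by move=> s /=; rewrite !in_itv/= andbT => /andP[].
rewrite -lee_fin -(Lq_haar_cum r0 bRV mb b_fin t0).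
apply: (Lq_haar_bound r0 _ sub _ _ _ NB).
- by rewrite invr_gt0.
- by move=> s /sub/pos_itv s0; rewrite ltW ?b0.
- by move=> s /pos_itv s0; rewrite !mulr_ge0 ?powR_ge0 ?K_ge0// ltW ?b0.
- move=> s hs; have s0 := pos_itv (sub _ hs).
  move: hs; rewrite /= in_itv/= => /andP[_ /ltW st].
  rewrite ler_pdivlMl// powR_inv1 ?(ltW s0)//.
  have -> : s^-1 * b s * K s f = s^-1 * K s f * b s by ring.
  rewrite ler_pM2r ?b0// /g ler_pdivrMl// mulrCA ler_pdivlMl//.
  exact: (Kfun_div_nonincreasing n0 n1).
Qed.

(** At the endpoint 1, K(u, f)/u need not decay as u tends to 0. Only the tail beyond [t] is damped;
    near 0 the norm is controlled by [b] through [cum r b t]. *)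
Lemma interp1_norm_upper (ka : R) : 0 < ka -> exists2 C : R, 0 < C & forall f (t Q : R),
  sumA f -> 0 < t -> 0 < Q ->
  (forall u, 0 < u -> u^-1 * b u * K u f <= Q * (b u * damp ka t u)) ->
  (interp_norm A0 A1 1 r b f <= (C * Q * cum r b t)%:E)%E.
Proof.
move=> ka0; have [C C0 H] := Lq_haar_damp_cum r0 bRV mb b_fin ka0.
exists C => // f t Q sf t0 Q0 HQ; rewrite interp_normE mulrAC mulrC.
apply: (Lq_haar_bound r0 Q0 (@subset_refl _ _) _ _ _ (H _ t0)).
- by move=> s /pos_itv s0; rewrite !mulr_ge0 ?powR_ge0 ?K_ge0// ltW ?b0.
- by move=> s /pos_itv s0; rewrite mulr_ge0 ?damp_ge0 ?ltW ?b0.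
- by move=> s /pos_itv s0; rewrite powR_inv1 ?(ltW s0)//; exact: HQ.
Qed.

End Endpoint.

End Spaces.

(** * Holmstedt-type estimates *)

Section Holmstedt.
Variables (R : realType) (V : lmodType R) (A0 A1 : qspace V).
Hypotheses (sA0 : Defs.subspace A0) (sA1 : Defs.subspace A1)
  (qA0 : is_quasinorm A0) (qA1 : is_quasinorm A1).
Variables (th0 : R) (q0 r0 r1 : \bar R) (b0 b1 a0 : R -> R).
Hypotheses (th0_gt0 : 0 < th0) (q0_gt0 : (0 < q0)%E) (r0_gt0 : (0 < r0)%E) (r1_gt0 : (0 <
    r1)%E).
Hypotheses (b0SV : SV b0) (b1SV : SV b1) (a0SV : SV a0).
Let be s := b0 s / a0 s.
Hypotheses (be_fin : (Lq_haar r0 `]0%R, 1%R[ be < +oo)%E) (b1_fin : (Lq_haar r1 `]0%R, 1%R[ b1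
    < +oo)%E).

Let c0 t := a0 t * cum r0 be t.
Let c1 := cum r1 b1.
Let rho t := t `^ (1 - th0) * (c0 t / c1 t).
Let X0 := interpR A0 A1 th0 r0 b0 q0 a0.
Let X1 := interp A0 A1 1 r1 b1.

Local Notation K := (Kfun A0 A1).
Local Notation sumA := (sum_space A0 A1).

Let n0 x : carrier A0 x -> 0 <= qnorm A0 x. Proof. by case: qA0 => + _ _ _; apply. Qed.
Let n1 x : carrier A1 x -> 0 <= qnorm A1 x. Proof. by case: qA1 => + _ _ _; apply. Qed.

Let beRV : RV 0 be.
Proof. by rewrite -(subr0 0); apply: RV_div; exact: SV_RV. Qed.

Lemma c0_RV : RV 0 c0.
Proof.
rewrite -(addr0 0); apply: RVM; first exact: SV_RV.
by apply: cum_RV => //; exact: SV_div_measurable.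
Qed.

Lemma c1_RV : RV 0 c1.
Proof. by apply: cum_RV => //; [exact: SV_RV|case: b1SV]. Qed.

Lemma rho_RV : RV (1 - th0) rho.
Proof.
rewrite -[X in RV X _]addr0; apply: RVM; first exact: RV_powR.
by rewrite -(subr0 0); apply: RV_div; [exact: c0_RV|exact: c1_RV].
Qed.

(** The origin of [rho]: it gives the lower bounds for the two end spaces the same weight at [t]. *)
Let rho_c1 t : 0 < t -> rho t * (t^-1 * c1 t) = t `^ (- th0) * c0 t.
Proof.
move=> t0; rewrite /rho -(powR_inv1 (ltW t0)).
have -> : t `^ (- th0) = t `^ (1 - th0) * t `^ (-1).
  by rewrite -powRD ?(gt_eqF t0) ?implybT//; congr (_ `^ _); ring.
by field; rewrite gt_eqF// (RV_gt0 c1_RV).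
Qed.

Let qnorm0E f : carrier X0 f -> interpR_norm A0 A1 th0 r0 b0 q0 a0 f = (qnorm X0 f)%:E.
Proof. by move=> [_ h]; rewrite /= fineK// ge0_fin_numE ?Lq_norm_ge0. Qed.

Let qnorm1E f : carrier X1 f -> interp_norm A0 A1 1 r1 b1 f = (qnorm X1 f)%:E.
Proof. by move=> [_ h]; rewrite /= fineK// ge0_fin_numE ?Lq_norm_ge0. Qed.

Lemma interpR_qnorm_ge0 f : carrier X0 f -> 0 <= qnorm X0 f.
Proof. by move=> _; rewrite fine_ge0 ?Lq_norm_ge0. Qed.

Lemma interp_qnorm_ge0 f : carrier X1 f -> 0 <= qnorm X1 f.
Proof. by move=> _; rewrite fine_ge0 ?Lq_norm_ge0. Qed.

Lemma sum_space_interp f : sum_space X0 X1 f -> sumA f.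
Proof.
move=> [f0 [f1 [[s0 _] [s1 _] ->]]]; exact: sum_spaceD.
Qed.

(** For any decomposition over the end spaces, each piece is bounded below by its own K at [t];
    quasi-subadditivity of K recombines them. In [C + 1], [C] belongs to the first space and 1 to
    the second. *)
Lemma Kfun_interp_lower : exists2 C : R, 0 < C & forall f t,
  sum_space X0 X1 f -> 0 < t ->
  t `^ (- th0) * c0 t * K t f <= C * Kfun X0 X1 (rho t) f.
Proof.
have [Cq Cq0 Hq] := KfunD sA0 sA1 qA0 qA1.
have [C C_0 H0] := interpR_norm_lower qA0 qA1 th0 r0_gt0 q0_gt0 b0SV a0SV be_fin.
have C10 : 0 < C + 1 by rewrite addr_gt0.
exists (Cq * (C + 1)) => [|f t sf t0]; first by rewrite mulr_gt0.
have rho0 : 0 < rho t by exact: (RV_gt0 rho_RV).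
have c0_0 : 0 < c0 t by exact: (RV_gt0 c0_RV).
rewrite -ler_pdivrMl ?mulr_gt0//; apply: le_Kfun => // f0 f1 cf0 cf1 fE.
rewrite ler_pdivrMl ?mulr_gt0//.
have [sf0 _] := cf0; have [sf1 _] := cf1.
have w0 : 0 < t `^ (- th0) * c0 t by rewrite mulr_gt0 ?powR_gt0.
have h0 : t `^ (- th0) * c0 t * K t f0 <= C * qnorm X0 f0.
  rewrite /c0 mulrA; apply: H0 => //; first exact: interpR_qnorm_ge0.
  by rewrite qnorm0E.
have h1 : t `^ (- th0) * c0 t * K t f1 <= rho t * qnorm X1 f1.
  rewrite -rho_c1// -mulrA ler_pM2l//.
  apply: (interp1_norm_lower qA0 qA1 r1_gt0 b1SV b1_fin) => //.
    exact: interp_qnorm_ge0.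
  by rewrite qnorm1E.
rewrite fE; apply: (le_trans (ler_wpM2l (ltW w0) (Hq _ _ _ (ltW t0) sf0 sf1))).
rewrite mulrCA -[leRHS]mulrA ler_pM2l// [leLHS]mulrDr; apply: (le_trans (lerD h0 h1)).
have := interpR_qnorm_ge0 cf0; have := mulr_ge0 (ltW rho0) (interp_qnorm_ge0 cf1).
by move: (qnorm X0 f0) (rho t * _) => x y x0 y0; nra.
Qed.

Variables (w : R -> R) (et : R).
Hypotheses (wRV : RV (- et) w) (th0et : th0 < et) (et1 : et < 1).

(** A decomposition nearly optimal at the single point [t] must be controlled at every [u]. For u >=
    t, K(u, f0) is at most the norm of f0; for u <= t one writes f0 = f - f1 and uses K(u, f1) <= u
    |f1|. For f1 the roles are exchanged. Both interpolation norms come out finite, whence the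
    membership. *)
Lemma Kfun_interp_upper : exists2 de : R, 0 < de & exists2 C : R, 0 < C &
  forall f (t S : R), sumA f -> 0 < t -> 0 < S ->
  (forall u, 0 < u -> w u * K u f <= S * expR (de * `|ln u - ln t|)) ->
  sum_space X0 X1 f /\
  w t * Kfun X0 X1 (rho t) f <= C * S * (t `^ (- th0) * c0 t).
Proof.
(* [th0] drives the decay for f0 beyond [t], [et - th0] that for f0 below [t], and [1 - et] that for
   f1 beyond [t]. *)
pose m := Num.min th0 (Num.min (et - th0) (1 - et)).
have m0 : 0 < m by rewrite !lt_min th0_gt0 !subr_gt0 th0et et1.
have m1 : m <= th0 by rewrite ge_min lexx.
have m2 : m <= et - th0 by rewrite !ge_min lexx orbT.
have m3 : m <= 1 - et by rewrite !ge_min lexx !orbT.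
(* At most three errors [e] enter one exponent, and m - 3m/8 still exceeds ka = m/2. *)
pose e := m / 8; have e0 : 0 < e by rewrite divr_gt0.
pose ka := m / 2; have ka0 : 0 < ka by rewrite divr_gt0.
have [Cq Cq0 Hq] := KfunD sA0 sA1 qA0 qA1.
have iwRV : RV et (fun u => (w u)^-1) by rewrite -(opprK et); exact: RV_inv.
have PRV : RV (- th0) (fun u => u `^ (- th0) * a0 u).
  by rewrite -[X in RV X _]addr0; apply: RVM; [exact: RV_powR|exact: SV_RV].
have [C1 C10 H1] := RV_le iwRV e0.
have [C2 C20 H2] := RV_le PRV e0.
have [C3 C30 H3] := interpR_norm_upper qA0 qA1 th0 r0_gt0 q0_gt0 b0SV a0SV be_fin ka0.
have [C4 C40 H4] := interp1_norm_upper qA0 qA1 r1_gt0 b1SV b1_fin ka0.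
(* [M0] and [M1] add up the constants of the ranges below and beyond [t], for f0 and f1
   respectively. *)
pose M0 := C2 * Cq * (C1 + 2) + C2 * 2.
pose M1 := Cq * (C1 + 2) + 2.
have M00 : 0 < M0 by rewrite addr_gt0 ?mulr_gt0 ?addr_gt0.
have M10 : 0 < M1 by rewrite addr_gt0 ?mulr_gt0 ?addr_gt0.
exists e => //; exists (C3 * M0 + C4 * M1) => [|f t S sf t0 S0 HS].
  by rewrite addr_gt0 ?mulr_gt0.
have w0 u : 0 < u -> 0 < w u by exact: (RV_gt0 wRV).
have a00 u : 0 < u -> 0 < a0 u by case: a0SV => + _ _; apply.
have b10 u : 0 < u -> 0 < b1 u by case: b1SV => + _ _; apply.
have rho0 : 0 < rho t by exact: (RV_gt0 rho_RV).
(* K(t, f) < 2 z strictly, so a decomposition of cost below 2 z exists even if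
   K(t, f) = 0. *)
pose z := S / w t; have z0 : 0 < z by rewrite divr_gt0 ?w0.
have Kt : K t f < 2 * z.
  have := HS t t0; rewrite subrr normr0 mulr0 expR0 mulr1 mulrC -ler_pdivlMr ?w0// -/z.
  by move=> h; apply: (le_lt_trans h); rewrite mulr2n mulrDl mul1r ltrDl.
have [f0 [f1 [cf0 cf1 fE fz]]] := Kfun_lt sf Kt.
have nf0 := n0 cf0; have nf1 := mulr_ge0 (ltW t0) (n1 cf1).
have f0z : qnorm A0 f0 <= 2 * z by lra.
have f1z : t * qnorm A1 f1 <= 2 * z by lra.
have sf0 : sumA f0 by exact: sum_space_left.
have sf1 : sumA f1 by exact: sum_space_right.
(* One [e] comes from the growth allowed by the hypothesis, the other from replacing [w u] by
   [w t]. *)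
have Kf u : 0 < u -> K u f <= C1 * expR (et * (ln u - ln t) + 2 * e * `|ln u - ln t|) * z.
  move=> u0; have := HS u u0; rewrite mulrC -ler_pdivlMr ?w0// => /le_trans; apply.
  have SE0 : 0 <= S * expR (e * `|ln u - ln t|) by rewrite mulr_ge0 ?expR_ge0 ?(ltW S0).
  apply: (le_trans (ler_wpM2l SE0 (H1 _ _ u0 t0))).
  have -> : et * (ln u - ln t) + 2 * e * `|ln u - ln t| =
    et * (ln u - ln t) + e * `|ln u - ln t| + e * `|ln u - ln t| by ring.
  by rewrite [in leRHS]expRD le_eqVlt; apply/orP; left; apply/eqP; rewrite /z; ring.
have lnD u : 0 < u -> u = t * expR (ln u - ln t).
  by move=> u0; rewrite expRB !lnK ?posrE// mulrCA divff ?gt_eqF// mulr1.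
pose P u := u `^ (- th0) * a0 u.
have P0 u : 0 < u -> 0 < P u by exact: (RV_gt0 PRV).
have N0 : (interpR_norm A0 A1 th0 r0 b0 q0 a0 f0 <= (C3 * (M0 * P t * z) * cum r0 be t)%:E)%E.
  apply: H3 => //; first by apply: mulr_gt0 => //; apply: mulr_gt0 => //; exact: P0.
  move=> u u0; have := H2 _ _ u0 t0; rewrite -/(P u) -/(P t).
  have [ut|tu] := leP u t.
  - have Dn : ln u - ln t = - `|ln u - ln t|.
      by rewrite ler0_norm ?opprK// subr_le0 ler_ln ?posrE.
    have Ku : K u f0 <= Cq * (C1 * expR (et * - `|ln u - ln t| + 2 * e * `|ln u - ln t|) +
        2 * expR (- `|ln u - ln t|)) * z.
      have -> : f0 = f + (- f1) by rewrite fE addrK.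
      have cf1N := subspaceN sA1 cf1.
      apply: (le_trans (Hq _ _ _ (ltW u0) sf (sum_space_right sA0 cf1N))).
      rewrite -mulrA ler_pM2l// mulrDl; apply: lerD; first by rewrite -Dn; exact: Kf.
      apply: (le_trans (Kfun_right sA0 qA0 qA1 (ltW u0) cf1N)).
      rewrite quasinormN//; have uE := lnD u u0; rewrite Dn in uE.
      rewrite [X in X * _ <= _]uE mulrAC [leRHS]mulrAC; apply: ler_wpM2r => //.
    have D0 := normr_ge0 (ln u - ln t).
    rewrite [X in expR (- th0 * X + _)]Dn.
    move: Ku D0; move: `|ln u - ln t| => D Ku D0 Pu.
    apply: (le_trans (ler_pM (ltW (P0 _ u0)) (Kfun_ge0 n0 n1 (ltW u0) sf0) Pu Ku)).
    have h1 : expR (- th0 * - D + e * D) * expR (et * - D + 2 * e * D) <= expR (- ka * D).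
      by rewrite -expRD ler_expR /e /ka; nra.
    have h2 : expR (- th0 * - D + e * D) * expR (- D) <= expR (- ka * D).
      by rewrite -expRD ler_expR /e /ka; nra.
    have -> : C2 * expR (- th0 * - D + e * D) * P t *
      (Cq * (C1 * expR (et * - D + 2 * e * D) + 2 * expR (- D)) * z) =
      C2 * Cq * P t * z * (C1 * (expR (- th0 * - D + e * D) * expR (et * - D + 2 * e * D)) +
        2 * (expR (- th0 * - D + e * D) * expR (- D))) by ring.
    have Y0 : 0 <= C2 * Cq * P t * z.
      by apply: mulr_ge0; [apply: mulr_ge0; [apply: mulr_ge0|]|]; apply: ltW => //; exact: P0.
    apply: (le_trans (ler_wpM2l Y0 (lerD (ler_wpM2l (ltW C10) h1) (ler_wpM2l (ler0n _ 2)
        h2)))).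
    rewrite -subr_ge0.
    have -> : M0 * P t * z * expR (- ka * D) - C2 * Cq * P t * z * (C1 * expR (- ka * D) + 2 *
        expR (- ka * D)) =
      C2 * 2 * (P t * z) * expR (- ka * D) by rewrite /M0; ring.
    apply: mulr_ge0; last exact: expR_ge0.
    apply: mulr_ge0; first by rewrite mulr_ge0// ltW.
    by apply: mulr_ge0; apply: ltW => //; exact: P0.
  - have Dp : ln u - ln t = `|ln u - ln t|.
      by rewrite ger0_norm// subr_ge0 ler_ln ?posrE// ltW.
    have Ku : K u f0 <= 2 * z.
      by apply: (le_trans (Kfun_left sA1 qA0 qA1 (ltW u0) cf0)).
    have D0 := normr_ge0 (ln u - ln t).
    rewrite [X in expR (- th0 * X + _)]Dp.
    move: D0; move: `|ln u - ln t| => D D0 Pu.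
    apply: (le_trans (ler_pM (ltW (P0 _ u0)) (Kfun_ge0 n0 n1 (ltW u0) sf0) Pu Ku)).
    have h1 : expR (- th0 * D + e * D) <= expR (- ka * D).
      by rewrite ler_expR /e /ka; nra.
    have -> : C2 * expR (- th0 * D + e * D) * P t * (2 * z) =
      C2 * 2 * P t * z * expR (- th0 * D + e * D) by ring.
    have Y0 : 0 <= C2 * 2 * P t * z.
      by apply: mulr_ge0; [apply: mulr_ge0; [apply: mulr_ge0|]|]; apply: ltW => //; exact: P0.
    apply: (le_trans (ler_wpM2l Y0 h1)); apply: ler_wpM2r; first exact: expR_ge0.
    apply: ler_wpM2r; first exact: ltW.
    apply: ler_wpM2r; first by rewrite ltW ?P0.
    by rewrite lerDr !mulr_ge0 ?addr_ge0 ?ltW.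
have N1 : (interp_norm A0 A1 1 r1 b1 f1 <= (C4 * (M1 * (t^-1 * z)) * c1 t)%:E)%E.
  apply: H4 => //; first by apply: mulr_gt0 => //; apply: mulr_gt0 => //; rewrite invr_gt0.
  move=> u u0.
  have ub0 : 0 <= u^-1 * b1 u by rewrite mulr_ge0 ?invr_ge0 ?ltW ?b10.
  have [ut|tu] := leP u t.
  - rewrite damp_near// mulr1.
    apply: (le_trans (ler_wpM2l ub0 (Kfun_right sA0 qA0 qA1 (ltW u0) cf1))).
    have -> : u^-1 * b1 u * (u * qnorm A1 f1) = b1 u * (t^-1 * (t * qnorm A1 f1)).
      by field; rewrite !gt_eqF.
    rewrite mulrC ler_wpM2r ?(ltW (b10 _ u0))// [leRHS]mulrCA ler_wpM2l ?invr_ge0 ?(ltW t0)//.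
    apply: (le_trans f1z); rewrite ler_pM2r// lerDr mulr_ge0 ?addr_ge0 ?(ltW Cq0) ?(ltW C10)//.
  - have Dp : ln u - ln t = `|ln u - ln t|.
      by rewrite ger0_norm// subr_ge0 ler_ln ?posrE// ltW.
    have Ku : K u f1 <= Cq * (C1 * expR (et * `|ln u - ln t| + 2 * e * `|ln u - ln t|) + 2) *
        z.
      have -> : f1 = f + (- f0) by rewrite fE addrC addKr.
      have cf0N := subspaceN sA0 cf0.
      apply: (le_trans (Hq _ _ _ (ltW u0) sf (sum_space_left sA1 cf0N))).
      rewrite -mulrA ler_pM2l// mulrDl; apply: lerD.
        by rewrite -{1}Dp; exact: Kf.
      apply: (le_trans (Kfun_left sA1 qA0 qA1 (ltW u0) cf0N)).
      by rewrite quasinormN.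
    have D0 := normr_ge0 (ln u - ln t).
    have uE := lnD u u0; rewrite Dp in uE.
    rewrite damp_far// ?(ltW tu)//.
    move: Ku D0 uE; move: `|ln u - ln t| => D Ku D0 uE.
    apply: (le_trans (ler_wpM2l ub0 Ku)).
    have -> : u^-1 = t^-1 * expR (- D) by rewrite uE invfM expRN.
    have h1 : expR (- D) * expR (et * D + 2 * e * D) <= expR (- ka * D).
      by rewrite -expRD ler_expR /e /ka; nra.
    have h2 : expR (- D) <= expR (- ka * D).
      by rewrite ler_expR /ka; nra.
    have -> : t^-1 * expR (- D) * b1 u * (Cq * (C1 * expR (et * D + 2 * e * D) + 2) * z) =
      t^-1 * b1 u * Cq * z * (C1 * (expR (- D) * expR (et * D + 2 * e * D)) + 2 * expR (- D))
          by ring.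
    have Y0 : 0 <= t^-1 * b1 u * Cq * z.
      by apply: mulr_ge0; [apply: mulr_ge0; [apply: mulr_ge0|]|]; apply: ltW => //; [rewrite
          invr_gt0|exact: b10].
    apply: (le_trans (ler_wpM2l Y0 (lerD (ler_wpM2l (ltW C10) h1) (ler_wpM2l (ler0n _ 2)
        h2)))).
    rewrite -subr_ge0.
    have -> : M1 * (t^-1 * z) * (b1 u * expR (- ka * D)) -
      t^-1 * b1 u * Cq * z * (C1 * expR (- ka * D) + 2 * expR (- ka * D)) =
      2 * (t^-1 * z) * (b1 u * expR (- ka * D)) by rewrite /M1; ring.
    apply: mulr_ge0.
      apply: mulr_ge0 => //; apply: mulr_ge0; last exact: ltW.
      by rewrite invr_ge0 ltW.
    by apply: mulr_ge0; [rewrite ltW ?b10|exact: expR_ge0].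
have X0f : carrier X0 f0 by split=> //; exact: le_lt_trans N0 (ltry _).
have X1f : carrier X1 f1 by split=> //; exact: le_lt_trans N1 (ltry _).
split; first by exists f0, f1.
rewrite fE; apply: (le_trans (ler_wpM2l (ltW (w0 _ t0))
  (Kfun_le interpR_qnorm_ge0 interp_qnorm_ge0 (ltW rho0) X0f X1f))).
move: N0 N1; rewrite qnorm0E// qnorm1E// !lee_fin => N0 N1.
apply: (le_trans (ler_wpM2l (ltW (w0 _ t0)) (lerD N0 (ler_wpM2l (ltW rho0) N1)))).
have -> : rho t * (C4 * (M1 * (t^-1 * z)) * c1 t) = C4 * M1 * z * (t `^ (- th0) * c0 t).
  by rewrite -rho_c1//; ring.
rewrite le_eqVlt; apply/orP; left; apply/eqP.
by rewrite /P /c0 /z; field; rewrite gt_eqF// w0.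
Qed.

End Holmstedt.

(** * Weights and assembly of the two embeddings *)

(** The constants enter through inequalities, so that the same [A] and [C] can later be used for
    both [F] and [G]. *)
Lemma moderate_RVM (R : realType) (al : R) (w : R -> R) : RV al w ->
  exists2 C : R, 0 < C & forall A C' (k : R -> R), `|al| + 2 <= A -> C <= C' ->
   (forall t, 0 < t -> 0 <= k t) ->
   (forall s t, 0 < s -> 0 < t -> k s <= expR `|ln s - ln t| * k t) ->
   moderate A C' (fun t => w t * k t).
Proof.
move=> wRV; have [C C0 H] := RV_le wRV ltr01; exists C => // A C' k AA CC k0 kH s t s0 t0.
have w0 u : 0 < u -> 0 < w u by exact: (RV_gt0 wRV).
split; first by rewrite mulr_ge0 ?k0// ltW ?w0.
apply: (le_trans (ler_pM (ltW (w0 _ s0)) (k0 _ s0) (H _ _ s0 t0) (kH _ _ s0 t0))).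
rewrite mulrACA; apply: ler_wpM2r; first by rewrite mulr_ge0 ?k0// ltW ?w0.
rewrite -mulrA -expRD; apply: ler_pM => //; rewrite ?expR_ge0 ?(ltW C0)//.
rewrite ler_expR.
have := ler_norm (al * (ln s - ln t)); rewrite normrM.
have := ler_wpM2r (normr_ge0 (ln s - ln t)) AA.
move: (`|ln s - ln t|) (`|al|) => x y; lra.
Qed.

(** With x = c0(t) and y = c1(t) the left side is rho(t)^(-theta); the identity is the source of
    [eta] and of the powers in [asharp]. *)
Lemma powR_weight (R : realType) (th th0 t x y : R) : 0 < t -> 0 < x -> 0 < y ->
  (t `^ (1 - th0) * (x / y)) `^ (- th) =
  t `^ (- ((1 - th) * th0 + th)) * (x `^ (1 - th) * y `^ th) / (t `^ (- th0) * x).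
Proof.
move=> t0 x0 y0.
have p z e : 0 < z -> 0 < z `^ e :> R by exact: powR_gt0.
have xy : 0 < x / y by rewrite divr_gt0.
have l0 : 0 < t `^ (1 - th0) * (x / y) by rewrite mulr_gt0 ?p.
have num0 : 0 < x `^ (1 - th) * y `^ th by rewrite mulr_gt0 ?p.
have num1 : 0 < t `^ (- ((1 - th) * th0 + th)) * (x `^ (1 - th) * y `^ th).
  by rewrite mulr_gt0 ?p.
have den0 : 0 < t `^ (- th0) * x by rewrite mulr_gt0 ?p.
apply: ln_inj; rewrite ?posrE ?divr_gt0 ?p// ln_powR.
by rewrite !(lnM, lnV) ?posrE ?invr_gt0 ?p// !ln_powR; ring.
Qed.

Theorem theorem23 (R : realType) (V : topologicalLmodType R)
  (A0 A1 : qspace V) (hA : compatible_couple A0 A1)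
  (hcap : exists x, [/\ carrier A0 x, carrier A1 x & x <> 0])
  (theta theta0 : R) (htheta : 0 < theta < 1) (htheta0 : 0 < theta0 < 1)
  (q0 r r0 r1 : \bar R) (hq0 : (0 < q0)%E) (hr : (0 < r)%E)
  (hr0 : (0 < r0)%E) (hr1 : (0 < r1)%E)
  (a b0 b1 a0 : R -> R) (ha : SV a) (hb0 : SV b0) (hb1 : SV b1) (ha0 : SV a0)
  (h0 : (Lq_norm r0 `]0%R, 1%R[
           (fun s => (s `^ (- qinv r0) * (b0 s / a0 s))%:E) < +oo)%E)
  (h1 : (Lq_norm r1 `]0%R, 1%R[
           (fun s => (s `^ (- qinv r1) * b1 s)%:E) < +oo)%E) :
  let c0 := fun t : R => a0 t *
    fine (Lq_norm r0 `]0, t[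
      (fun s => (s `^ (- qinv r0) * (b0 s / a0 s))%:E)) in
  let c1 := fun t : R =>
    fine (Lq_norm r1 `]0, t[ (fun s => (s `^ (- qinv r1) * b1 s)%:E)) in
  let rho := fun t : R => t `^ (1 - theta0) * (c0 t / c1 t) in
  let eta := (1 - theta) * theta0 + theta in
  let asharp := fun t : R =>
    c0 t `^ (1 - theta) * c1 t `^ theta * a (rho t) in
  iso_spaces
    (interp (interpR A0 A1 theta0 r0 b0 q0 a0) (interp A0 A1 1 r1 b1)
       theta r a)
    (interp A0 A1 eta r asharp).
Proof.
move=> c0 c1 rho eta asharp.
have [_ [sA0 qA0 _] [sA1 qA1 _] _ _] := hA.
have [/andP[th0 th1] /andP[th00 th01]] := (htheta, htheta0).
have n0 x : carrier A0 x -> 0 <= qnorm A0 x by case: qA0 => + _ _ _; apply.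
have n1 x : carrier A1 x -> 0 <= qnorm A1 x by case: qA1 => + _ _ _; apply.
set X0 := interpR _ _ _ _ _ _ _; set X1 := interp A0 A1 1 r1 b1.
have m0 x : carrier X0 x -> 0 <= qnorm X0 x by exact: interpR_qnorm_ge0.
have m1 x : carrier X1 x -> 0 <= qnorm X1 x by exact: interp_qnorm_ge0.
have c0RV : RV 0 c0 by exact: (c0_RV hr0 hb0 ha0 h0).
have c1RV : RV 0 c1 by exact: (c1_RV hr1 hb1 h1).
have rhoRV : RV (1 - theta0) rho by exact: (rho_RV theta0 hr0 hr1 hb0 hb1 ha0 h0 h1).
have eta_th0 : theta0 < eta by rewrite /eta; nra.
have eta1 : eta < 1 by rewrite /eta; nra.
pose Wt t := rho t `^ (- theta) * a (rho t).
pose w t := t `^ (- eta) * asharp t.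
have wE t : 0 < t -> w t = Wt t * (t `^ (- theta0) * c0 t).
  move=> t0; have C0 : 0 < c0 t by exact: (RV_gt0 c0RV).
  have C1 : 0 < c1 t by exact: (RV_gt0 c1RV).
  have rt : 0 < rho t by exact: (RV_gt0 rhoRV).
  have -> : Wt t = t `^ (- eta) * (c0 t `^ (1 - theta) * c1 t `^ theta) /
      (t `^ (- theta0) * c0 t) * a (rho t).
    by congr (_ * _); exact: powR_weight.
  rewrite /w /asharp.
  by field; rewrite !gt_eqF ?powR_gt0.
have arhoRV : RV 0 (fun t => a (rho t)) by apply: RV_comp rhoRV; exact: SV_RV.
have wRV : RV (- eta) w.
  rewrite -(addr0 (- eta)); apply: RVM; first exact: RV_powR.
  rewrite -(addr0 0); apply: RVM => //; rewrite -(addr0 0); apply: RVM.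
    by rewrite -(mulr0 (1 - theta)); exact: RV_pow.
  by rewrite -(mulr0 theta); exact: RV_pow.
have aRV : RV (- theta) (fun s => s `^ (- theta) * a s).
  by rewrite -[X in RV X _]addr0; apply: RVM; [exact: RV_powR|exact: SV_RV].
have [C1 C10 H1] := moderate_RVM wRV; have [C2 C20 H2] := moderate_RVM aRV.
have [C3 C30 H3] := Kfun_interp_lower sA0 sA1 qA0 qA1 theta0 hq0 hr0 hr1 hb0 hb1 ha0 h0 h1.
have [de de0 [C4 C40 H4]] := Kfun_interp_upper sA0 sA1 qA0 qA1 th00 hq0 hr0 hr1 hb0 hb1 ha0 h0
    h1 wRV eta_th0 eta1.
rewrite -/X0 -/X1 in H3 H4.
pose A := `|- eta| + 2 + (`|- theta| + 2).
pose C := C1 + C2 + C3 + C4.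
have A_ge0 : 0 <= A by rewrite !addr_ge0.
have C_gt0 : 0 < C by rewrite !addr_gt0.
have rh0 t : 0 < t -> 0 < rho t by exact: (RV_gt0 rhoRV).
have ka0 : 0 < 1 - theta0 by rewrite subr_gt0.
pose G f t := w t * Kfun A0 A1 t f.
pose F f s := s `^ (- theta) * a s * Kfun X0 X1 s f.
have mG f : sum_space A0 A1 f -> moderate A C (G f).
  move=> sf; apply: H1.
  - by rewrite lerDl addr_ge0.
  - by rewrite /C -!addrA lerDl !addr_ge0 ?ltW.
  - by move=> t t0; apply: Kfun_ge0 => //; exact: ltW.
  - by move=> s t s0 t0; exact: Kfun_moderate.
have mF f : sum_space X0 X1 f -> moderate A C (F f).
  move=> sf; apply: H2.
  - by rewrite lerDr addr_ge0.
  - by rewrite /C -addrA -addrA addrCA lerDl !addr_ge0 ?ltW.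
  - by move=> t t0; apply: Kfun_ge0 => //; exact: ltW.
  - by move=> s t s0 t0; exact: Kfun_moderate.
have nF f : interp_norm X0 X1 theta r a f = Lq_haar r `]0, +oo[ (F f) by exact: interp_normE.
have nG f : interp_norm A0 A1 eta r asharp f = Lq_haar r `]0, +oo[ (G f) by exact:
    interp_normE.
have fin (N : \bar R) : (0 <= N)%E -> (N < +oo)%E -> N = (fine N)%:E.
  by move=> N0 Noo; rewrite fineK// ge0_fin_numE.
split.
- have [D D0 HD] := transfer_comp_le rhoRV ka0 hr A_ge0 C_gt0.
  have main f : carrier (interp X0 X1 theta r a) f -> sum_space A0 A1 f /\
      (interp_norm A0 A1 eta r asharp f <= (D * qnorm (interp X0 X1 theta r a) f)%:E)%E.
    move=> [sf /= Nf]; have sAf := sum_space_interp sA0 sA1 sf; split=> //.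
    rewrite nG; apply: (HD _ _ _ (mG _ sAf) (mF _ sf)).
    + move=> t t0; have Wt0 : 0 < Wt t by rewrite mulr_gt0 ?powR_gt0 ?rh0//; case: arhoRV => +
        _; apply.
      have K0 : 0 <= Kfun X0 X1 (rho t) f by apply: Kfun_ge0 => //; rewrite ltW ?rh0.
      rewrite /G wE// /F -/(Wt t) -mulrA [leRHS]mulrCA (ler_pM2l Wt0).
      apply: (le_trans (H3 _ _ sf t0)); apply: ler_wpM2r => //.
      by rewrite /C; lra.
    + by rewrite fine_ge0 ?Lq_norm_ge0.
    + by rewrite -nF -fin ?Lq_norm_ge0.
  split=> [f /main[sf Nf]|]; first by split=> //; exact: le_lt_trans Nf (ltry _).
  exists D => f /main[sf Nf].
  have Noo := le_lt_trans Nf (ltry _).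
  by rewrite -lee_fin /= -fin ?Lq_norm_ge0.
- have [D D0 HD] := transfer_sup_le rhoRV ka0 hr A_ge0 C_gt0 de0.
  have [E E0 HE] := moderate_pointwise hr A_ge0 C_gt0.
  have main f : carrier (interp A0 A1 eta r asharp) f -> sum_space X0 X1 f /\
      (interp_norm X0 X1 theta r a f <= (D * qnorm (interp A0 A1 eta r asharp) f)%:E)%E.
    move=> [sf /= Nf].
    have B0 : 0 <= fine (interp_norm A0 A1 eta r asharp f) by rewrite fine_ge0 ?Lq_norm_ge0.
    have NB : (Lq_haar r `]0%R, +oo[ (G f) <= (fine (interp_norm A0 A1 eta r asharp f))%:E)%E.
      by rewrite -nG -fin ?Lq_norm_ge0.
    (* [G f] is bounded, so the upper estimate applies at t = 1 with a constant [S]; the summand 1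
       makes [S] positive. Membership must precede the use of [mF]. *)
    have sXf : sum_space X0 X1 f.
      have [] := H4 f 1 (E * fine (interp_norm A0 A1 eta r asharp f) + 1) sf ltr01 => //.
        by rewrite ltr_wpDl ?mulr_ge0 ?(ltW E0).
      move=> u u0; apply: (le_trans (HE _ _ _ (mG _ sf) B0 NB u0)).
      apply: (@le_trans _ _ (E * fine (interp_norm A0 A1 eta r asharp f) + 1)); first by
          rewrite lerDl.
      rewrite ler_peMr ?addr_ge0 ?mulr_ge0 ?(ltW E0)// -[leLHS]expR0 ler_expR.
      by rewrite mulr_ge0 ?(ltW de0).
    split=> //; rewrite nF; apply: (HD _ _ _ (mG _ sf) (mF _ sXf)) => // t S t0 S0 HS.
    have [_] := H4 f t S sf t0 S0 HS.
    have p0 : 0 < t `^ (- theta0) * c0 t by apply: mulr_gt0; [exact: powR_gt0|exact: (RV_gt0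
        c0RV)].
    rewrite wE// mulrAC [leRHS]mulrC [leLHS]mulrC (ler_pM2l p0) => /le_trans; apply.
    by rewrite ler_pM2r// /C; lra.
  split=> [f /main[sf Nf]|]; first by split=> //; exact: le_lt_trans Nf (ltry _).
  exists D => f /main[sf Nf].
  have Noo := le_lt_trans Nf (ltry _).
  by rewrite -lee_fin /= -fin ?Lq_norm_ge0.
Qed.
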